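(* If the problem $Ax=0$, $x\in[0,1]^n$, $x\neq0$ is infeasible, then the time complexity $\mathsf{T_{BP}}$ of the Basic Procedure for the Primal Problem (defined in the context) satisfies $\mathsf{T_{BP}}=O(n^2m/\rho(Q_A))$, where $\rho(Q_A)$ is the condition number defined in the context. In particular, $\rho(Q_A)$ equals $1/\sqrt n$ under well-condition (e.g., when $A$ is an identity matrix), and then $\mathsf{T_{BP}}=O(n^{2.5}m)$ if the problem $Ax=0$, $x\in[0,1]^n$, $x\ne0$ is infeasible.
   Context: Here $A\in\mathbb{R}^{m\times n}$ is an integer (or rational) matrix with $\operatorname{rank}(A)=m$ (or the current matrix obtained from such a matrix by rescaling and deleting columns; it then has $r\le n$ columns, and $[0,1]^n$ is replaced by $[0,1]^r$). Time is counted in arithmetic operations; the step-size $c\in(0,2)$ is a fixed constant. Vector inequalities are coordinatewise, $\mathbf 1$ is the all-ones vector, $e_k$ the $k$th unit vector, $x^+=\max\{0,x\}$ coordinatewise. $Q_A=A^T(AA^T)^\dagger A$ and $P_A=I-Q_A$, with $(\cdot)^\dagger$ the Moore-Penrose pseudoinverse. For a vector $y$ put $v=Q_Ay$ and, for each $j$ with $v_j\ne0$, $\mathrm{bound}_j(y)=\mathbf 1^T\big[\frac{v}{-v_j}\big]^+$. For a matrix $Q$ with columns $q_i$, the condition number is $\rho(Q)=\max_{x:\|x\|_2=1}\min_i\langle x,\frac{q_i}{\|q_i\|_2}\rangle$. Basic Procedure for the Primal Problem. Input: $Q_A$ of size $r\times r$, $r\le n$. Set $\mathrm{threshold}=\frac1{2r^{3/2}}$,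 $y=\mathbf 1/r$, $v=Q_Ay$; throughout $z=y-v=P_Ay$. Repeat the following iteration: (1) if $z>0$, return with case $=1$ (primal feasible); (2) else if $v>0$ and $r=n$, return with case $=2$ (dual feasible); (3) else let $K=\{k:v_k\le0\}$, $q_K=Q_A\sum_{k\in K}e_k$, $\alpha=\langle\frac{q_K}{\|q_K\|_2},v\rangle$ (with $\alpha:=0$ if $q_K=0$). If $\alpha\le-\mathrm{threshold}$, replace $y$ by $y-c\frac{\alpha}{\|q_K\|_2}\sum_{k\in K}e_k$ and $v$ by $v-c\frac{\alpha}{\|q_K\|_2}q_K$. Otherwise return with case $=0$ and a nonempty set $J\subseteq\{j:\mathrm{bound}_j(y)\le\frac12\}$. At the start of the procedure a one-time preprocessing of $Q_A$ costing $O(mn^2)$ operations may be performed; it is included in $\mathsf{T_{BP}}$. *)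

(* Defs.v *)
From HB Require Import structures.
From mathcomp Require Import all_boot all_order all_algebra.
From mathcomp Require Import boolp classical_sets reals.

Set Implicit Arguments.
Unset Strict Implicit.
Unset Printing Implicit Defensive.

Import Order.TTheory GRing.Theory Num.Theory.
Local Open Scope classical_set_scope.
Local Open Scope ring_scope.

(** * Linear algebra *)

Definition dot (R : realType) n (u v : 'cV[R]_n) : R :=
  \sum_i u i 0 * v i 0.

Definition norm2 (R : realType) n (u : 'cV[R]_n) : R :=
  Num.sqrt (\sum_i u i 0 ^+ 2).

Definition moore_penrose (R : realType) p q (M : 'M[R]_(p, q))
    (X : 'M[R]_(q, p)) : Prop :=
  [/\ M *m X *m M = M, X *m M *m X = X,
      (M *m X)^T = M *m X & (X *m M)^T = X *m M].

Definition pinv (R : realType) p q (M : 'M[R]_(p, q)) : 'M[R]_(q, p) :=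
  xget 0 [set X | moore_penrose M X].

Lemma gram_unit (R : realType) p q (F : 'M[R]_(p, q)) :
  row_free F -> F *m F^T \in unitmx.
Proof.
move=> freeF; rewrite -row_free_unit -kermx_eq0; apply/eqP/row_matrixP => i.
rewrite row0; set u := row i _.
have uG : u *m (F *m F^T) = 0 by rewrite -row_mul mulmx_ker row0.
have uF : u *m F = 0.
  set w := u *m F.
  have : (w *m w^T) 0 0 = 0.
    by rewrite /w trmx_mul mulmxA -(mulmxA u) uG mul0mx mxE.
  rewrite mxE => /eqP; rewrite psumr_eq0 => [/allP h|j _]; last first.
    by rewrite [X in _ * X]mxE -expr2 sqr_ge0.
  apply/rowP => j; have := h j (mem_index_enum j).
  by rewrite [X in _ * X]mxE -expr2 sqrf_eq0 => /eqP ->; rewrite mxE.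
by apply: (row_free_inj freeF); rewrite uF mul0mx.
Qed.

Lemma pinvP (R : realType) p q (M : 'M[R]_(p, q)) : moore_penrose M (pinv M).
Proof.
suff : exists X, moore_penrose M X by move=> MX; apply: xgetPex MX.
have [k [C [F [MCF freeF fullC]]]] :
    exists k (C : 'M_(p, k)) (F : 'M_(k, q)),
      [/\ M = C *m F, row_free F & row_full C].
  exists (\rank M), (col_base M), (row_base M); rewrite mulmx_base.
  by split; [|exact: row_base_free|exact: col_base_full].
have uF : F *m F^T \in unitmx by exact: gram_unit.
have uC : C^T *m C \in unitmx.
  rewrite -{2}[C]trmxK; apply: gram_unit.
  by rewrite /row_free mxrank_tr.
pose GF := invmx (F *m F^T); pose GC := invmx (C^T *m C).
have sGF : GF^T = GF by rewrite trmx_inv trmx_mul trmxK.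
have sGC : GC^T = GC by rewrite trmx_inv trmx_mul trmxK.
pose X := F^T *m GF *m GC *m C^T.
have MX : M *m X = C *m GC *m C^T.
  rewrite MCF /X !mulmxA -(mulmxA C F) -(mulmxA C (F *m F^T)).
  by rewrite mulmxV // mulmx1.
have XM : X *m M = F^T *m GF *m F.
  rewrite MCF /X !mulmxA -(mulmxA (F^T *m GF *m GC) C^T C).
  by rewrite -(mulmxA (F^T *m GF) GC) mulVmx // mulmx1.
exists X; split.
- rewrite MX MCF !mulmxA -(mulmxA (C *m GC) C^T C).
  by rewrite -(mulmxA C GC) mulVmx // mulmx1.
- rewrite XM /X !mulmxA -(mulmxA (F^T *m GF) F F^T).
  by rewrite -(mulmxA (F^T *m GF) (F *m F^T)) mulmxV // mulmx1.
- by rewrite MX !trmx_mul trmxK sGC mulmxA.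
- by rewrite XM !trmx_mul trmxK sGF mulmxA.
Qed.

Definition QA (R : realType) m r (A : 'M[R]_(m, r)) : 'M[R]_r :=
  A^T *m pinv (A *m A^T) *m A.

(* For r > 0 the infimum ranges over finitely many values, hence is a minimum,
   and the supremum is that of a continuous function on the unit sphere, hence
   is a maximum. *)
Definition rho (R : realType) p r (Q : 'M[R]_(p, r)) : R :=
  sup [set inf [set dot x ((norm2 (col i Q))^-1 *: col i Q) | i in [set: 'I_r]]
      | x in [set x : 'cV[R]_p | norm2 x = 1]].

(** * The feasibility problem *)

(* A arises from a rational matrix A0 of full row rank by keeping the columns
   f 0, ..., f (r - 1) and scaling them by positive factors; A0 itself is the
   case r = n, f = id, d = 1.  Injectivity of f entails r <= n. *)
Definition current_matrix (R : realType) m n r (A : 'M[R]_(m, r)) : Prop :=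
  exists (A0 : 'M[rat]_(m, n)) (f : 'I_r -> 'I_n) (d : 'I_r -> R),
    [/\ \rank A0 = m, injective f, forall j, 0 < d j &
        A = \matrix_(i, j) (d j * ratr (A0 i (f j)))].
Arguments current_matrix [R] m n r A.

Definition primal_infeasible (R : realType) m r (A : 'M[R]_(m, r)) : Prop :=
  ~ exists x : 'cV[R]_r,
      [/\ A *m x = 0, forall j, 0 <= x j 0 <= 1 & x <> 0].

(** * The Basic Procedure *)

(* 1 / (2 r^(3/2)) *)
Definition threshold (R : realType) (r : nat) : R :=
  (2 * Num.sqrt (r%:R ^+ 3))^-1.

Definition bound (R : realType) r (v : 'cV[R]_r) (j : 'I_r) : R :=
  \sum_i Num.max 0 (v i 0 / - v j 0).

Definition sumK (R : realType) r (v : 'cV[R]_r) : 'cV[R]_r :=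
  \sum_(k | v k 0 <= 0) delta_mx k 0.

Definition qK (R : realType) r (Q : 'M[R]_r) (v : 'cV[R]_r) : 'cV[R]_r :=
  Q *m sumK v.

Definition alpha (R : realType) r (Q : 'M[R]_r) (v : 'cV[R]_r) : R :=
  if qK Q v == 0 then 0 else dot ((norm2 (qK Q v))^-1 *: qK Q v) v.

Inductive outcome (R : realType) (r : nat) : Type :=
| PrimalFeasible
| DualFeasible
| Cut of {set 'I_r}
| Continue of 'cV[R]_r & 'cV[R]_r.
Arguments PrimalFeasible {R r}.
Arguments DualFeasible {R r}.
Arguments Cut {R r} _.
Arguments Continue {R r} _ _.

(* The result of one iteration started at (y, v), where z = y - v.  It is a
   relation because any admissible J may be returned. *)
Inductive bp_iter (R : realType) (c : R) (n r : nat) (Q : 'M[R]_r)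
    (y v : 'cV[R]_r) : outcome R r -> Prop :=
| BPCase1 of (forall i, 0 < (y - v) i 0) : bp_iter c n Q y v PrimalFeasible
| BPCase2 of ~ (forall i, 0 < (y - v) i 0)
    & (forall i, 0 < v i 0) /\ r = n : bp_iter c n Q y v DualFeasible
| BPUpdate of ~ (forall i, 0 < (y - v) i 0)
    & ~ ((forall i, 0 < v i 0) /\ r = n)
    & alpha Q v <= - threshold R r :
    bp_iter c n Q y v
      (Continue (y - (c * (alpha Q v / norm2 (qK Q v))) *: sumK v)
                (v - (c * (alpha Q v / norm2 (qK Q v))) *: qK Q v))
| BPCase0 (J : {set 'I_r}) of ~ (forall i, 0 < (y - v) i 0)
    & ~ ((forall i, 0 < v i 0) /\ r = n)
    & ~ (alpha Q v <= - threshold R r)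
    & J != finset.set0
    & (forall j, j \in J -> v j 0 != 0 /\ bound v j <= 2^-1) :
    bp_iter c n Q y v (Cut J).

Definition y0 (R : realType) (r : nat) : 'cV[R]_r := const_mx r%:R^-1.

(* (y, v) is the iterate after t updates. *)
Inductive bp_reaches (R : realType) (c : R) (n r : nat) (Q : 'M[R]_r) :
    nat -> 'cV[R]_r -> 'cV[R]_r -> Prop :=
| BPStart : bp_reaches c n Q 0 (y0 R r) (Q *m y0 R r)
| BPNext t y v y' v' of bp_reaches c n Q t y v
    & bp_iter c n Q y v (Continue y' v') : bp_reaches c n Q t.+1 y' v'.

(** * Arithmetic cost model: a real random access machine *)

(* Real numbers are stored in two-dimensional arrays, numbered by nat, and are
   only accessible to the four arithmetic operations and to comparison.  Arrays
   are addressed through natural-number index registers.  There is no square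
   root: the test alpha <= - threshold and the updates of y and v can be
   rewritten in terms of squared norms. *)
Inductive index := Reg of nat | Imm of nat.

Inductive cell := Cell of nat & index & index.

Inductive arith := Add | Sub | Mul | Div.

Inductive cmd :=
| Skip
| Seq of cmd & cmd
| Const of cell & nat
| Arith of cell & arith & cell & cell
| IfLe of cell & cell & cmd & cmd
| SetReg of nat & index
| IncReg of nat
| For of nat & index & cmd.

Record state (R : realType) := State {
  mem : nat -> nat -> nat -> R;
  reg : nat -> nat;
  time : nat
}.

Definition index_val (R : realType) (s : state R) (i : index) : nat :=
  match i with Reg k => reg s k | Imm k => k end.

Definition read (R : realType) (s : state R) (x : cell) : R :=
  let: Cell a i j := x in mem s a (index_val s i) (index_val s j).

Definition write (R : realType) (s : state R) (x : cell) (q : R) : state R :=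
  let: Cell a i j := x in
  State (fun a' i' j' =>
           if [&& a' == a, i' == index_val s i & j' == index_val s j]
           then q else mem s a' i' j')
        (reg s) (time s).

Definition write_reg (R : realType) (s : state R) (k p : nat) : state R :=
  State (mem s) (fun k' => if k' == k then p else reg s k') (time s).

Definition tick (R : realType) (s : state R) : state R :=
  State (mem s) (reg s) (time s).+1.

Definition arith_val (R : realType) (o : arith) (x y : R) : R :=
  match o with
  | Add => x + y | Sub => x - y | Mul => x * y | Div => x / y
  end.

(* Index bookkeeping and every pass through a loop are charged as well, so the
   elapsed time is at least the number of arithmetic operations.  The number of
   passes of a loop is fixed on entry. *)
Fixpoint exec (R : realType) (p : cmd) (s : state R) {struct p} : state R :=
  match p with
  | Skip => s
  | Seq p1 p2 => exec p2 (exec p1 s)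
  | Const x k => tick (write s x k%:R)
  | Arith x o a b => tick (write s x (arith_val o (read s a) (read s b)))
  | IfLe a b p1 p2 =>
      if read s a <= read s b then exec p1 (tick s) else exec p2 (tick s)
  | SetReg k i => tick (write_reg s k (index_val s i))
  | IncReg k => tick (write_reg s k (reg s k).+1)
  | For k b body =>
      iteri (index_val s b) (fun i s' => exec body (tick (write_reg s' k i)))
            (tick s)
  end.

(** * Machine implementations of the Basic Procedure *)

(* The preprocessing, which also sets up the initial y and v, is run once, then
   the body once per iteration. *)
Record program := Program { preprocessing : cmd; body : cmd }.

(* Array 0 holds Q, array 1 the step size; registers 0 and 1 hold n and r. *)
Definition init_state (R : realType) (c : R) (n r : nat) (Q : 'M[R]_r) :
    state R :=
  State (fun a i j =>
           match a with
           | 0%N => if (insub i, insub j) is (Some i', Some j')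
                    then Q i' j' else 0
           | 1%N => c
           | _ => 0
           end)
        (fun k => match k with 0%N => n | 1%N => r | _ => 0%N end)
        0.

Definition run (R : realType) (P : program) (c : R) (n r : nat)
    (Q : 'M[R]_r) (t : nat) : state R :=
  iter t (exec (body P)) (exec (preprocessing P) (init_state c n Q)).

Definition holds (R : realType) r (s : state R) (y v : 'cV[R]_r) : Prop :=
  forall i : 'I_r, mem s 2 i 0 = y i 0 /\ mem s 3 i 0 = v i 0.

(* Array 4 is the halting flag, array 5 the case, array 6 the indicator of J. *)
Definition halted (R : realType) (s : state R) : Prop := mem s 4 0 0 = 1.

Definition reports (R : realType) r (s : state R) (o : outcome R r) : Prop :=
  match o with
  | PrimalFeasible => halted s /\ mem s 5 0 0 = 1
  | DualFeasible => halted s /\ mem s 5 0 0 = 2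
  | Cut J => [/\ halted s, mem s 5 0 0 = 0 &
                 forall j : 'I_r, mem s 6 j 0 = (j \in J)%:R]
  | Continue y v => ~ halted s /\ holds s y v
  end.

(* One and the same program serves all sizes, step sizes and matrices, feasible
   or not; its body performs exactly one iteration of the procedure. *)
Definition implements_bp (R : realType) (P : program) : Prop :=
  forall (c : R) (m n r : nat) (A : 'M[R]_(m, r)),
    0 < c < 2 -> (0 < r)%N -> current_matrix m n r A ->
    forall t y v, bp_reaches c n (QA A) t y v ->
      holds (run P c n (QA A) t) y v /\
      exists2 o, bp_iter c n (QA A) y v o & reports (run P c n (QA A) t.+1) o.

Definition cheap_preprocessing (R : realType) (P : program) : Prop :=
  exists C : R, forall (c : R) (m n r : nat) (A : 'M[R]_(m, r)),
    0 < c < 2 -> (0 < m)%N -> (0 < r)%N -> current_matrix m n r A ->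
    (time (run P c n (QA A) 0))%:R <= C * (m%:R * n%:R ^+ 2).

(* P halts on Q after T units of time, preprocessing included. *)
Definition bp_time (R : realType) (P : program) (c : R) (n r : nat)
    (Q : 'M[R]_r) (T : nat) : Prop :=
  exists t, [/\ halted (run P c n Q t.+1),
                forall t', (t' < t)%N -> ~ halted (run P c n Q t'.+1) &
                T = time (run P c n Q t.+1)].

(* Main.v *)
(** Let x be a unit vector with <x, q_i> >= d |q_i| for all i, d = rho(Q) / 2;
    Gordan's theorem gives rho(Q) > 0.  By the triangle inequality an update
    raises <x, v> by at least c d threshold, while |v| never increases and is at
    most r^(-1/2) initially; hence O(r / rho(Q)) iterations.  An iteration costs
    O(r m): Q is an orthogonal projection of rank at most m, so Gram-Schmidt on
    its columns writes Q = L^T W with at most m rows in O(m r^2) steps, each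
    pivot lowering the trace by one, and q_K = L^T (W 1_K).  Square roots are
    avoided since alpha <= - threshold means 0 < |q_K|^2 <= 4 r^3 <q_K, v>^2,
    and J is found in O(r) steps since bound_j = - <q_K, v> / v_j when v_j > 0.
    In case 0 such a J is nonempty: z > 0 fails, so some v_j >= y_j >= 1 / r,
    while - <q_K, v> < threshold |q_K| <= 1 / (2 r) unless q_K = 0. *)

Require Import Defs.
From mathcomp Require Import all_boot all_order all_algebra.
From mathcomp Require Import boolp classical_sets reals.
From mathcomp Require Import ring lra zify.

Import Order.TTheory GRing.Theory Num.Theory.
Local Open Scope ring_scope.

Set Implicit Arguments.
Unset Strict Implicit.
Unset Printing Implicit Defensive.

(** * Frame conditions and running times *)

(** One sign fact recurs. Every iterate satisfies [Q *m v = v], so the inner product of [q_K] and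
    [v] is the sum of the nonpositive entries of [v]. This makes squaring the test on [alpha] an
    equivalence, keeps every entry of [y] at least [1 / r], and identifies [bound] with a quotient
    the machine can compute.

    The running time is not a function of the sizes alone: the number of pivots depends on the data.
    Costs read off the program text therefore charge the loops over rows to register 2, and the
    content of that register is identified with the trace of [Q]. That trace is at most [m] even
    when deleting columns has made [A] rank deficient.

    Since the procedure is a relation, following it by a deterministic machine needs one more
    remark: only the set [J] is free, so a continuing run leaves the machine no choice. *)

Fixpoint written_arrays (p : cmd) : seq nat :=
  match p with
  | Const (Cell a _ _) _ | Arith (Cell a _ _) _ _ _ => [:: a]
  | Seq p1 p2 | IfLe _ _ p1 p2 => written_arrays p1 ++ written_arrays p2
  | For _ _ p1 => written_arrays p1
  | Skip | SetReg _ _ | IncReg _ => [::]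
  end.

Fixpoint written_regs (p : cmd) : seq nat :=
  match p with
  | SetReg k _ | IncReg k => [:: k]
  | Seq p1 p2 | IfLe _ _ p1 p2 => written_regs p1 ++ written_regs p2
  | For k _ p1 => k :: written_regs p1
  | Skip | Const _ _ | Arith _ _ _ _ => [::]
  end.

Fixpoint loop_bounds (p : cmd) : seq nat :=
  match p with
  | Seq p1 p2 | IfLe _ _ p1 p2 => loop_bounds p1 ++ loop_bounds p2
  | For _ (Reg k) p1 => k :: loop_bounds p1
  | For _ (Imm _) p1 => loop_bounds p1
  | _ => [::]
  end.

(* An upper bound for the running time when the registers bounding the loops
   keep the values given by e. *)
Fixpoint cost (e : nat -> nat) (p : cmd) : nat :=
  match p with
  | Skip => 0
  | Seq p1 p2 => cost e p1 + cost e p2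
  | IfLe _ _ p1 p2 => (maxn (cost e p1) (cost e p2)).+1
  | For _ b p1 =>
      (match b with Reg k => e k | Imm k => k end * (cost e p1).+1).+1
  | _ => 1
  end.

Local Notation smem := Defs.mem.

Section Machine.
Variable R : realType.
Implicit Types (s : state R) (p : cmd).

Lemma iteri_inv (T : Type) (I : nat -> T -> Prop) N (f : nat -> T -> T) x :
  I 0%N x -> (forall i z, (i < N)%N -> I i z -> I i.+1 (f i z)) ->
  I N (iteri N f x).
Proof.
move=> I0 IS; elim: N IS => [//|N IH] IS /=.
by apply: (IS) => //; apply: IH => i z /ltnW; exact: IS.
Qed.

(** The condition concerns the program text only, so for concrete programs it is settled by
    computation. *)
Lemma exec_mem p s (a i j : nat) :
  a \notin written_arrays p -> smem (exec p s) a i j = smem s a i j.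
Proof.
elim: p s => //= [p1 IH1 p2 IH2|[b i1 j1] k|[b i1 j1] o x y|x y p1 IH1 p2 IH2
  |k b p1 IH1] s.
- by rewrite mem_cat negb_or => /andP[h1 h2]; rewrite IH2 ?IH1.
- by rewrite inE /write /= => /negPf ->.
- by rewrite inE /write /= => /negPf ->.
- by rewrite mem_cat negb_or => /andP[h1 h2]; case: ifP => _; rewrite ?IH2 ?IH1.
- move=> h.
  apply: (@iteri_inv _ (fun _ s' => smem s' a i j = smem s a i j)) => //.
  by move=> n z _; rewrite IH1.
Qed.

Lemma exec_reg p s (k : nat) :
  k \notin written_regs p -> reg (exec p s) k = reg s k.
Proof.
elim: p s => //= [p1 IH1 p2 IH2|[b i1 j1] n|[b i1 j1] o x y|x y p1 IH1 p2 IH2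
  |n i|n|n b p1 IH1] s //.
- by rewrite mem_cat negb_or => /andP[h1 h2]; rewrite IH2 ?IH1.
- by rewrite mem_cat negb_or => /andP[h1 h2]; case: ifP => _; rewrite ?IH2 ?IH1.
- by rewrite inE => /negPf ->.
- by rewrite inE => /negPf ->.
- rewrite inE negb_or => /andP[/negPf kn h].
  apply: (@iteri_inv _ (fun _ s' => reg s' k = reg s k)) => //.
  by move=> l z _ <-; rewrite IH1 //= kn.
Qed.

(** No register of [D] is written, loop counters included, so [e] still gives the correct number of
    passes on entry to every nested loop. *)
Lemma exec_cost (D : seq nat) (e : nat -> nat) p s :
  {in D, reg s =1 e} -> all (mem D) (loop_bounds p) ->
  all (predC (mem D)) (written_regs p) ->
  (time (exec p s) <= time s + cost e p)%N.
Proof.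
elim: p s => /= [|p1 IH1 p2 IH2|[b i1 j1] n|[b i1 j1] o x y
  |x y p1 IH1 p2 IH2|n i|n|n b p1 IH1] s; rewrite ?addn0 ?addn1 //=.
- rewrite !all_cat => De /andP[b1 b2] /andP[w1 w2].
  have De1 : {in D, reg (exec p1 s) =1 e}.
    move=> k kD; rewrite exec_reg ?De //.
    by apply: contraTN kD => /(allP w1).
  by have := IH1 s De b1 w1; have := IH2 _ De1 b2 w2; lia.
- rewrite !all_cat => De /andP[b1 b2] /andP[w1 w2].
  by case: ifP => _; [have := IH1 (tick s) De b1 w1
    | have := IH2 (tick s) De b2 w2] => /=; lia.
- move=> De hb /andP[nD w1].
  have b1 : all (mem D) (loop_bounds p1) by case: b hb => //= k /andP[].
  have -> : match b with Reg k => e k | Imm k => k end = index_val s b.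
    by case: b hb => //= k /andP[kD _]; rewrite De.
  set f := (fun _ _ => exec _ _); set N := index_val s b.
  suff [] : {in D, reg (iteri N f (tick s)) =1 e} /\
     (time (iteri N f (tick s)) <= time s + (N * (cost e p1).+1).+1)%N by [].
  apply: (@iteri_inv _ (fun i s' => {in D, reg s' =1 e} /\
     (time s' <= time s + (i * (cost e p1).+1).+1)%N)) => [|i z _ [ze zt]].
    by split => //=; lia.
  have ze' : {in D, reg (tick (write_reg z n i)) =1 e}.
    move=> k kD /=; case: eqP => [kn|_]; last exact: ze.
    by rewrite -kn kD in nD.
  split=> [k kD|].
    rewrite /f exec_reg ?ze' //.
    by apply: contraTN kD => /(allP w1).
  by rewrite /f; have := IH1 _ ze' b1 w1 => /=; lia.
Qed.

(** The loop rule hands the frame conditions back to the step, relative to the state before the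
    loop. An invariant [I] thus has to describe only the cells that change. *)
Lemma exec_for (I : nat -> state R -> Prop) k b p s :
  I 0%N (tick s) ->
  (forall n s', (n < reg s b)%N ->
    (forall a i j, a \notin written_arrays p -> smem s' a i j = smem s a i j) ->
    (forall l, l \notin k :: written_regs p -> reg s' l = reg s l) ->
    I n s' -> I n.+1 (exec p (tick (write_reg s' k n)))) ->
  I (reg s b) (exec (For k (Reg b) p) s).
Proof.
move=> I0 IS /=; set f := (fun _ _ => exec _ _); set N := reg s b in IS *.
suff [] : [/\ forall a i j, a \notin written_arrays p ->
       smem (iteri N f (tick s)) a i j = smem s a i j,
     forall l, l \notin k :: written_regs p ->
       reg (iteri N f (tick s)) l = reg s l & I N (iteri N f (tick s))] by [].
apply: (@iteri_inv _ (fun n s' => [/\ forall a i j, a \notin written_arrays p ->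
       smem s' a i j = smem s a i j,
     forall l, l \notin k :: written_regs p -> reg s' l = reg s l & I n s'])).
  by split.
move=> n z nN [fm fr In]; split=> [a i j ha|l hl|]; last exact: IS.
  by rewrite /f exec_mem //= fm.
rewrite /f exec_reg; last by move: hl; rewrite inE negb_or => /andP[].
by move: (hl); rewrite inE negb_or /= => /andP[/negPf-> _]; exact: fr.
Qed.

Lemma exec_seq p1 p2 s : exec (Seq p1 p2) s = exec p2 (exec p1 s).
Proof. by []. Qed.

End Machine.

Local Notation "p ;; q" := (Seq p q) (at level 60, right associativity).

(** * The program *)

Definition scal (a : nat) : cell := Cell a (Imm 0) (Imm 0).
Definition entry (a i : nat) : cell := Cell a (Reg i) (Imm 0).
Definition entry2 (a i j : nat) : cell := Cell a (Reg i) (Reg j).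

(* Arrays (2 to 6 hold y, v, flag, case and J): 0 residual matrix, initially Q,
   1 step size, 7 and 8 the factors L and W of Q = L^T W, 9 r, 10 n, 11 zero,
   12 one, 13 4 r^3, 14 and 20 scratch, 15 <q_K, v>, 16 q_K, 17 |q_K|^2,
   18 and 19 the tests of cases 1 and 2.
   Register 2 is the number of rows of L and W, 3 to 5 are loop counters. *)
Definition constants : cmd :=
  Const (scal 12) 1 ;;
  For 3 (Reg 1) (Arith (scal 9) Add (scal 9) (scal 12)) ;;
  For 3 (Reg 0) (Arith (scal 10) Add (scal 10) (scal 12)) ;;
  Const (scal 13) 4 ;;
  Arith (scal 13) Mul (scal 13) (scal 9) ;;
  Arith (scal 13) Mul (scal 13) (scal 9) ;;
  Arith (scal 13) Mul (scal 13) (scal 9).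

Definition start_y : cmd :=
  For 3 (Reg 1) (Arith (entry 2 3) Div (scal 12) (scal 9)).

Definition start_v_entry : cmd :=
  For 4 (Reg 1)
    (Arith (scal 14) Div (entry2 0 3 4) (scal 9) ;;
     Arith (entry 3 3) Add (entry 3 3) (scal 14)).

Definition start_v : cmd := For 3 (Reg 1) start_v_entry.

(** Adding the zero of array 11 serves as a copy. The division by the pivot goes into the row of [W]
    alone, so that the product of the two new rows is the rank-one matrix to subtract. *)
Definition new_row : cmd :=
  For 4 (Reg 1)
    (Arith (entry2 7 2 4) Add (entry2 0 4 3) (scal 11) ;;
     Arith (entry2 8 2 4) Div (entry2 0 4 3) (entry2 0 3 3)).

Definition deflate_row : cmd :=
  For 5 (Reg 1)
    (Arith (scal 14) Mul (entry2 7 2 4) (entry2 8 2 5) ;;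
     Arith (entry2 0 4 5) Defs.Sub (entry2 0 4 5) (scal 14)).

Definition deflate : cmd := For 4 (Reg 1) deflate_row.

Definition pivot : cmd := new_row ;; deflate ;; IncReg 2.

(** A diagonal entry of a projection is nonnegative and vanishes only with its whole column, so the
    comparison with zero decides whether there is anything left to remove. *)
Definition gram_schmidt : cmd :=
  For 3 (Reg 1) (IfLe (entry2 0 3 3) (scal 11) Skip pivot).

Definition clear_q : cmd := For 3 (Reg 1) (Const (entry 16 3) 0).

Definition sum_W : cmd :=
  Const (scal 14) 0 ;;
  For 3 (Reg 1)
    (IfLe (entry 3 3) (scal 11)
       (Arith (scal 14) Add (scal 14) (entry2 8 4 3)) Skip).

Definition add_row : cmd :=
  For 3 (Reg 1)
    (Arith (scal 20) Mul (entry2 7 4 3) (scal 14) ;;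
     Arith (entry 16 3) Add (entry 16 3) (scal 20)).

Definition compute_q : cmd := clear_q ;; For 4 (Reg 2) (sum_W ;; add_row).

Definition compute_dots : cmd :=
  Const (scal 15) 0 ;;
  Const (scal 17) 0 ;;
  For 3 (Reg 1)
    (Arith (scal 14) Mul (entry 16 3) (entry 3 3) ;;
     Arith (scal 15) Add (scal 15) (scal 14) ;;
     Arith (scal 14) Mul (entry 16 3) (entry 16 3) ;;
     Arith (scal 17) Add (scal 17) (scal 14)).

Definition test_z : cmd :=
  Const (scal 18) 1 ;;
  For 3 (Reg 1) (IfLe (entry 2 3) (entry 3 3) (Const (scal 18) 0) Skip).

Definition test_v : cmd :=
  Const (scal 19) 1 ;;
  For 3 (Reg 1) (IfLe (entry 3 3) (scal 11) (Const (scal 19) 0) Skip) ;;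
  IfLe (scal 10) (scal 9) Skip (Const (scal 19) 0).

Definition stop (k : nat) : cmd := Const (scal 4) 1 ;; Const (scal 5) k.

(** In each pass [y] is changed before [v], because membership in [K] is read off the old entry of
    [v]. *)
Definition update : cmd :=
  Arith (scal 14) Div (scal 15) (scal 17) ;;
  Arith (scal 14) Mul (scal 1) (scal 14) ;;
  For 3 (Reg 1)
    (IfLe (entry 3 3) (scal 11)
       (Arith (entry 2 3) Defs.Sub (entry 2 3) (scal 14)) Skip ;;
     Arith (scal 20) Mul (scal 14) (entry 16 3) ;;
     Arith (entry 3 3) Defs.Sub (entry 3 3) (scal 20)).

(** For a positive entry [v_j], the condition that the bound is at most [1/2] reads
    [v_j + 2 <q_K, v> >= 0]; cell 14 holds the doubled product. *)
Definition cut : cmd :=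
  stop 0 ;;
  Arith (scal 14) Add (scal 15) (scal 15) ;;
  For 3 (Reg 1)
    (Const (entry 6 3) 0 ;;
     IfLe (entry 3 3) (scal 11) Skip
       (Arith (scal 20) Add (entry 3 3) (scal 14) ;;
        IfLe (scal 11) (scal 20) (Const (entry 6 3) 1) Skip)).

(** A vanishing [q_K] is tested separately: there [alpha] is 0 by convention and a cut is due,
    whereas the squared comparison alone would hold as [0 <= 0]. *)
Definition decide : cmd :=
  IfLe (scal 12) (scal 18) (stop 1)
    (IfLe (scal 12) (scal 19) (stop 2)
       (Arith (scal 14) Mul (scal 13) (scal 15) ;;
        Arith (scal 14) Mul (scal 14) (scal 15) ;;
        IfLe (scal 17) (scal 11) cut
          (IfLe (scal 17) (scal 14) update cut))).

Definition iteration : cmd :=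
  compute_q ;; compute_dots ;; test_z ;; test_v ;; decide.

(** * Effect of each subprogram on the memory *)

Section ProgramSpecs.
Variable R : realType.
Implicit Types (s : state R).

(** A register cannot be read as a real number, so [r] and [n] are counted up by loops that add
    ones; this is why arrays 9 and 10 must start at zero. *)
Lemma constants_spec s : smem s 9 0 0 = 0 -> smem s 10 0 0 = 0 ->
  let s' := exec constants s in
  [/\ smem s' 9 0 0 = (reg s 1)%:R, smem s' 10 0 0 = (reg s 0)%:R,
      smem s' 12 0 0 = 1 & smem s' 13 0 0 = 4 * (reg s 1)%:R ^+ 3].
Proof.
move=> h9 h10; rewrite /constants !exec_seq.
set s1 := exec (Const _ _) s.
have e1 : smem s1 12 0 0 = 1 by rewrite /s1 /= /write /=.
set s2 := exec (For _ _ _) s1.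
have e2 : smem s2 9 0 0 = (reg s 1)%:R.
  rewrite /s2; apply: (@exec_for _ (fun n s' => smem s' 9 0 0 = n%:R)) => //.
  move=> n s' _ fm fr In; rewrite /= /write /read /scal /=.
  by rewrite In fm // e1 -natr1.
set s3 := exec (For _ _ _) s2.
have e3 : smem s3 10 0 0 = (reg s 0)%:R.
  have -> : reg s 0 = reg s2 0 by rewrite /s2 exec_reg.
  rewrite /s3; apply: (@exec_for _ (fun n s' => smem s' 10 0 0 = n%:R)) => //.
    by rewrite /= /s2 exec_mem.
  move=> n s' _ fm fr In; rewrite /= /write /read /scal /=.
  by rewrite In fm // /s2 exec_mem // e1 -natr1.
have e9 : smem s3 9 0 0 = (reg s 1)%:R by rewrite /s3 exec_mem.
have e12 : smem s3 12 0 0 = 1 by rewrite /s3 exec_mem // /s2 exec_mem.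
by rewrite /= /write /read /scal /= e9 e3 e12; split=> //; ring.
Qed.

Lemma start_y_spec s i : smem s 12 0 0 = 1 -> (i < reg s 1)%N ->
  smem (exec start_y s) 2 i 0 = (smem s 9 0 0)^-1.
Proof.
move=> h12 ir.
pose I n s' := ((i < n)%N -> smem s' 2 i 0 = (smem s 9 0 0)^-1) : Prop.
suff H : I (reg s 1) (exec start_y s) by exact: H.
rewrite /start_y; apply: (@exec_for _ I) => //= n s' /= ns fm fr In; rewrite /I.
rewrite /= /write /read /scal /= andbT ltnS leq_eqVlt.
by case: eqP => //= _ _; rewrite !fm // h12 div1r.
Qed.

(** Stated for every row [i], touched or not, because the invariant of the outer loop follows a
    fixed row while the register moves. *)
Lemma start_v_entry_spec s i :
  smem (exec start_v_entry s) 3 i 0 = smem s 3 i 0 +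
    (\sum_(k < reg s 1) smem s 0 i k * (smem s 9 0 0)^-1) *+ (i == reg s 3).
Proof.
pose I n s' := smem s' 3 i 0 = smem s 3 i 0 +
    (\sum_(k < n) smem s 0 i k * (smem s 9 0 0)^-1) *+ (i == reg s 3).
apply: (@exec_for _ I) => [|n s' /= ns fm fr In]; rewrite /I.
  by rewrite big_ord0 mul0rn addr0.
rewrite /= /write /read /scal /= andbT fr // (fm 0%N) // (fm 9%N) //.
rewrite big_ord_recr /=.
by move: In; rewrite /I; case: eqP => [-> ->|//]; rewrite !mulr1n addrA.
Qed.

Lemma start_v_spec s i : smem s 3 i 0 = 0 -> (i < reg s 1)%N ->
  smem (exec start_v s) 3 i 0 =
    \sum_(k < reg s 1) smem s 0 i k * (smem s 9 0 0)^-1.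
Proof.
move=> h3 ir.
pose I n s' := smem s' 3 i 0 =
    (\sum_(k < reg s 1) smem s 0 i k * (smem s 9 0 0)^-1) *+ (i < n)%N.
suff H : I (reg s 1) (exec start_v s) by rewrite H ir.
rewrite /start_v; apply: (@exec_for _ I) => [|n s' /= ns fm fr In].
  by rewrite /I mulr0n.
rewrite /I.
rewrite start_v_entry_spec /= In fr // (fm 9%N) //.
under eq_bigr => k _ do rewrite (fm 0%N) //.
by rewrite -mulrnDr ltnS; case: ltngtP.
Qed.

Lemma new_row_spec s (a t i : nat) : (a == 7) || (a == 8) ->
  let u i' := if a == 7 then smem s 0 i' (reg s 3) + smem s 11 0 0
    else smem s 0 i' (reg s 3) / smem s 0 (reg s 3) (reg s 3) in
  smem (exec new_row s) a t i =
    if (t == reg s 2) && (i < reg s 1)%N then u i else smem s a t i.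
Proof.
move=> ha u; pose I n s' := smem s' a t i =
  if (t == reg s 2) && (i < n)%N then u i else smem s a t i.
rewrite /new_row; apply: (@exec_for _ I) => [|n s' /= ns fm fr In]; rewrite /I.
  by rewrite andbF.
rewrite /= /write /read /scal /= !fr // !(fm 0%N) // (fm 11%N) //.
rewrite ltnS leq_eqVlt; move: In; rewrite /I /u.
by case/orP: ha => /eqP -> /= ->; case: (t == _) => //=; case: eqP => // ->;
  rewrite ltnn.
Qed.

Lemma deflate_row_spec s i l :
  smem (exec deflate_row s) 0 i l = if (i == reg s 4) && (l < reg s 1)%N
    then smem s 0 i l - smem s 7 (reg s 2) i * smem s 8 (reg s 2) l
    else smem s 0 i l.
Proof.
pose I n s' := smem s' 0 i l = if (i == reg s 4) && (l < n)%N
    then smem s 0 i l - smem s 7 (reg s 2) i * smem s 8 (reg s 2) l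
    else smem s 0 i l.
rewrite /deflate_row; apply: (@exec_for _ I) => [|n s' /= ns fm fr In].
  by rewrite /I andbF.
rewrite /I.
rewrite /= /write /read /scal /= !fr // (fm 7%N) // (fm 8%N) //.
rewrite ltnS leq_eqVlt; move: In; rewrite /I.
case: eqP => [->|_ //] /=; case: eqP => [->|_ //] /=.
by rewrite ltnn => ->.
Qed.

Lemma deflate_spec s i l : (i < reg s 1)%N -> (l < reg s 1)%N ->
  smem (exec deflate s) 0 i l =
    smem s 0 i l - smem s 7 (reg s 2) i * smem s 8 (reg s 2) l.
Proof.
move=> ir lr; pose I n s' := smem s' 0 i l = if (i < n)%N
    then smem s 0 i l - smem s 7 (reg s 2) i * smem s 8 (reg s 2) l
    else smem s 0 i l.
suff H : I (reg s 1) (exec deflate s) by rewrite H ir.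
rewrite /deflate; apply: (@exec_for _ I) => [//|n s' /= ns fm fr In].
rewrite /I.
rewrite (deflate_row_spec (tick _)) /= !fr // lr (fm 7%N) // (fm 8%N) // In.
by rewrite andbT ltnS (leq_eqVlt i); case: eqP => //= ->; rewrite ltnn.
Qed.

Lemma pivot_spec s :
  let j := reg s 3 in let k := reg s 2 in let s' := exec pivot s in
  smem s 11 0 0 = 0 ->
  [/\ reg s' 2 = k.+1,
    forall i l, (i < reg s 1)%N -> (l < reg s 1)%N -> smem s' 0 i l =
      smem s 0 i l - smem s 0 i j * (smem s 0 l j / smem s 0 j j),
    forall i, (i < reg s 1)%N -> smem s' 7 k i = smem s 0 i j,
    forall i, (i < reg s 1)%N -> smem s' 8 k i = smem s 0 i j / smem s 0 j j &
    forall t i : nat, t != k ->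
      smem s' 7 t i = smem s 7 t i /\ smem s' 8 t i = smem s 8 t i].
Proof.
move=> j k s' h11; rewrite /s' /pivot !exec_seq.
set s1 := exec new_row s; set s2 := exec deflate s1.
have r1 (x : nat) : x \notin [:: 4%N] -> reg s1 x = reg s x.
  by move=> hx; rewrite exec_reg.
have e7 t i : smem (exec (IncReg 2) s2) 7 t i = smem s1 7 t i.
  by rewrite /= /s2 exec_mem.
have e8 t i : smem (exec (IncReg 2) s2) 8 t i = smem s1 8 t i.
  by rewrite /= /s2 exec_mem.
split=> [|i l ir lr|i ir|i ir|t i tk].
- by rewrite /= !exec_reg.
- rewrite -[LHS]/(smem (exec deflate s1) 0 i l) deflate_spec ?r1 //.
  have -> : smem s1 0 i l = smem s 0 i l by rewrite exec_mem.
  by rewrite !new_row_spec // eqxx ir lr /= h11 addr0.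
- by rewrite e7 new_row_spec // eqxx ir /= h11 addr0.
- by rewrite e8 new_row_spec // eqxx ir.
- by rewrite e7 e8 !new_row_spec // (negPf tk).
Qed.

Lemma sum_W_spec s :
  smem (exec sum_W s) 14 0 0 = \sum_(k < reg s 1)
    if smem s 3 k 0 <= smem s 11 0 0 then smem s 8 (reg s 4) k else 0.
Proof.
rewrite /sum_W exec_seq; set s1 := exec (Const _ _) s.
pose I n s' := smem s' 14 0 0 = \sum_(k < n)
    if smem s 3 k 0 <= smem s 11 0 0 then smem s 8 (reg s 4) k else 0.
apply: (@exec_for _ I) => [|n s' /= ns fm fr In]; rewrite /I.
  by rewrite big_ord0.
rewrite (fun_if (fun z => smem z _ _ _)) /= /write /read /scal /= fr //.
rewrite (fm 3%N) // (fm 11%N) // (fm 8%N) // In big_ord_recr /=.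
by case: ifP => // _; rewrite addr0.
Qed.

Lemma add_row_spec s i :
  smem (exec add_row s) 16 i 0 = smem s 16 i 0 +
    (if (i < reg s 1)%N then smem s 7 (reg s 4) i * smem s 14 0 0 else 0).
Proof.
pose I n s' := smem s' 16 i 0 = smem s 16 i 0 +
    (if (i < n)%N then smem s 7 (reg s 4) i * smem s 14 0 0 else 0).
rewrite /add_row; apply: (@exec_for _ I) => [|n s' /= ns fm fr In]; rewrite /I.
  by rewrite addr0.
rewrite /= /write /read /scal /= fr // (fm 7%N) // (fm 14%N) // andbT.
rewrite ltnS (leq_eqVlt i); move: In; rewrite /I.
by case: eqP => [-> ->|//] /=; rewrite ltnn addr0.
Qed.

Lemma compute_q_spec s i : (i < reg s 1)%N ->
  smem (exec compute_q s) 16 i 0 = \sum_(t < reg s 2) smem s 7 t i *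
    \sum_(k < reg s 1)
      (if smem s 3 k 0 <= smem s 11 0 0 then smem s 8 t k else 0).
Proof.
move=> ir; rewrite /compute_q exec_seq; set s1 := exec clear_q s.
have q0 : smem s1 16 i 0 = 0.
  pose I n s' := ((i < n)%N -> smem s' 16 i 0 = 0) : Prop.
  suff H : I (reg s 1) s1 by exact: H.
  rewrite /s1 /clear_q; apply: (@exec_for _ I) => [//|n s' /= ns fm fr In].
  rewrite /I /= /write /= ltnS leq_eqVlt andbT.
  by case: eqP.
have -> : reg s 2 = reg s1 2 by rewrite exec_reg.
pose I n s' := smem s' 16 i 0 = \sum_(t < n) smem s 7 t i *
    \sum_(k < reg s 1)
      (if smem s 3 k 0 <= smem s 11 0 0 then smem s 8 t k else 0).
apply: (@exec_for _ I) => [|n s' ns fm fr In]; rewrite /I.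
  by rewrite big_ord0.
rewrite exec_seq add_row_spec sum_W_spec !exec_reg // !exec_mem //.
have -> : reg (tick (write_reg s' 4 n)) 1 = reg s 1.
  by rewrite -[LHS]/(reg s' 1) fr // exec_reg.
rewrite ir /= In big_ord_recr /= !fm // exec_mem //; congr (_ + _ * _).
by apply: eq_bigr => k _; rewrite !fm // !exec_mem.
Qed.

Lemma compute_dots_spec s : let s' := exec compute_dots s in
  smem s' 15 0 0 = \sum_(k < reg s 1) smem s 16 k 0 * smem s 3 k 0 /\
  smem s' 17 0 0 = \sum_(k < reg s 1) smem s 16 k 0 * smem s 16 k 0.
Proof.
rewrite /compute_dots !exec_seq; set s1 := exec (Const (scal 17) _) _.
have e a k l : a \notin [:: 15; 17]%N -> smem s1 a k l = smem s a k l.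
  rewrite !inE negb_or => /andP[h1 h2].
  by rewrite /s1 !exec_mem // inE.
pose I n s' :=
  smem s' 15 0 0 = \sum_(k < n) smem s 16 k 0 * smem s 3 k 0 /\
  smem s' 17 0 0 = \sum_(k < n) smem s 16 k 0 * smem s 16 k 0.
have -> : reg s 1 = reg s1 1 by [].
apply: (@exec_for _ I) => [|n s' /= ns fm fr [I1 I2]]; rewrite /I.
  by rewrite !big_ord0; split.
rewrite /= /write /read /scal /= (fm 3%N) // (fm 16%N) // I1 I2 ?e //.
by rewrite !big_ord_recr.
Qed.

Lemma test_z_spec s : smem (exec test_z s) 18 0 0 =
  (all (fun i => smem s 3 i 0 < smem s 2 i 0) (iota 0 (reg s 1)))%:R.
Proof.
rewrite /test_z exec_seq; set s1 := exec (Const _ _) s.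
pose I n s' := smem s' 18 0 0 =
  (all (fun i => smem s 3 i 0 < smem s 2 i 0) (iota 0 n))%:R.
have -> : reg s 1 = reg s1 1 by [].
apply: (@exec_for _ I) => [//|n s' /= ns fm fr In].
rewrite /I -(addn1 n) iotaD all_cat add0n.
rewrite (fun_if (fun z => smem z _ _ _)) /= /write /read /scal /=.
rewrite (fm 3%N) // (fm 2%N) // In leNgt.
by case: (_ < _); rewrite ?andbT ?andbF.
Qed.

Lemma test_v_spec s : smem (exec test_v s) 19 0 0 =
  (all (fun i => smem s 11 0 0 < smem s 3 i 0) (iota 0 (reg s 1)) &&
   (smem s 10 0 0 <= smem s 9 0 0))%:R.
Proof.
rewrite /test_v !exec_seq; set s1 := exec (Const _ _) s.
set s2 := exec (For _ _ _) s1.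
have e2 : smem s2 19 0 0 =
  (all (fun i => smem s 11 0 0 < smem s 3 i 0) (iota 0 (reg s 1)))%:R.
  pose I n s' := smem s' 19 0 0 =
    (all (fun i => smem s 11 0 0 < smem s 3 i 0) (iota 0 n))%:R.
  have -> : reg s 1 = reg s1 1 by [].
  apply: (@exec_for _ I) => [//|n s' /= ns fm fr In].
  rewrite /I -(addn1 n) iotaD all_cat add0n.
  rewrite (fun_if (fun z => smem z _ _ _)) /= /write /read /scal /=.
  rewrite (fm 3%N) // (fm 11%N) // In leNgt.
  by case: (_ < _); rewrite ?andbT ?andbF.
have e10 : smem s2 10 0 0 = smem s 10 0 0 by rewrite /s2 exec_mem.
have e9 : smem s2 9 0 0 = smem s 9 0 0 by rewrite /s2 exec_mem.
rewrite (fun_if (fun z => smem z _ _ _)) /= /write /read /scal /= e2 e10 e9.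
by case: (_ <= _); rewrite ?andbT ?andbF.
Qed.

Lemma update_spec s i : let s' := exec update s in
  let g := smem s 1 0 0 * (smem s 15 0 0 / smem s 17 0 0) in
  (i < reg s 1)%N ->
  smem s' 2 i 0 =
    smem s 2 i 0 - (if smem s 3 i 0 <= smem s 11 0 0 then g else 0) /\
  smem s' 3 i 0 = smem s 3 i 0 - g * smem s 16 i 0.
Proof.
move=> s' g ir; rewrite /s' /update !exec_seq.
set s1 := exec (Arith _ Mul _ _) _.
have e14 : smem s1 14 0 0 = g by rewrite /s1 /= /write /read /=.
have e a k l : a != 14%N -> smem s1 a k l = smem s a k l.
  by move=> h; rewrite /s1 !exec_mem // inE.
pose I n s' :=
  smem s' 2 i 0 = (if (i < n)%N then
    smem s 2 i 0 - (if smem s 3 i 0 <= smem s 11 0 0 then g else 0)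
    else smem s 2 i 0) /\
  smem s' 3 i 0 = if (i < n)%N then smem s 3 i 0 - g * smem s 16 i 0
    else smem s 3 i 0.
suff [] : I (reg s1 1) (exec (For 3 (Reg 1)
    (IfLe (entry 3 3) (scal 11)
       (Arith (entry 2 3) Defs.Sub (entry 2 3) (scal 14)) Skip ;;
     Arith (scal 20) Mul (scal 14) (entry 16 3) ;;
     Arith (entry 3 3) Defs.Sub (entry 3 3) (scal 20))) s1).
  by rewrite -[reg s1 1]/(reg s 1) ir.
apply: (@exec_for _ I) => [|n z ns fm fr [I1 I2]]; rewrite /I.
  by rewrite !e.
rewrite 2!exec_seq; set z0 := tick _.
have e0 a k l : smem z0 a k l = smem z a k l by [].
have r0 : reg z0 3 = n by [].
set z1 := exec (IfLe _ _ _ _) _.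
have ez a k l : a != 2%N -> smem z1 a k l = smem z a k l.
  by move=> h; rewrite /z1 exec_mem ?e0 //= inE.
have rz : reg z1 3 = n by rewrite /z1 exec_reg.
have z2 : smem z1 2 i 0 = if (i == n) && (smem z 3 n 0 <= smem s 11 0 0)
    then smem z 2 n 0 - g else smem z 2 i 0.
  rewrite /z1 (fun_if (fun z => smem z _ _ _)).
  rewrite /= /write /read /scal /= !(fm 14%N, fm 11%N) // e14 !e //.
  by rewrite andbT; case: (i == n); case: (_ <= _).
rewrite [in X in X /\ _]exec_mem // [in X in X /\ _]exec_mem // z2.
rewrite /= /write /read /scal /= !ez // rz !(fm 14%N, fm 16%N) // e14.
rewrite !e // ltnS (leq_eqVlt i) andbT.
case: eqP I1 I2 => [->|_] /=; last by move=> -> ->.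
by rewrite ltnn => -> ->; case: ifP; rewrite ?subr0.
Qed.

Lemma cut_spec s : let s' := exec cut s in smem s 11 0 0 = 0 ->
  [/\ smem s' 4 0 0 = 1, smem s' 5 0 0 = 0 &
    forall i, (i < reg s 1)%N -> smem s' 6 i 0 = ((0 < smem s 3 i 0) &&
      (0 <= smem s 3 i 0 + (smem s 15 0 0 + smem s 15 0 0)))%:R].
Proof.
move=> s' h11; rewrite /s' /cut !exec_seq.
set s1 := exec (Arith _ Add _ _) _.
split=> [||i ir]; try by rewrite exec_mem // /s1 /= /write /=.
have e14 : smem s1 14 0 0 = smem s 15 0 0 + smem s 15 0 0.
  by rewrite /s1 /= /write /read /=.
have e a k l : a \notin [:: 4; 5; 14]%N -> smem s1 a k l = smem s a k l.
  rewrite !inE !negb_or => /and3P[h1 h2 h3].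
  by rewrite /s1 !exec_mem //= !inE ?negb_or ?h1.
pose I n (z : state R) := ((i < n)%N -> smem z 6 i 0 = ((0 < smem s 3 i 0) &&
  (0 <= smem s 3 i 0 + (smem s 15 0 0 + smem s 15 0 0)))%:R) : Prop.
have -> // : I (reg s1 1) (exec (For 3 (Reg 1)
    (Const (entry 6 3) 0 ;;
     IfLe (entry 3 3) (scal 11) Skip
       (Arith (scal 20) Add (entry 3 3) (scal 14) ;;
        IfLe (scal 11) (scal 20) (Const (entry 6 3) 1) Skip))) s1).
apply: (@exec_for _ I) => [//|n z ns fm fr In]; rewrite /I.
rewrite /= (fun_if (fun z => smem z _ _ _)) (fun_if (fun z => smem z _ _ _)).
rewrite /= /write /read /scal /= !(fm 14%N, fm 11%N, fm 3%N) // e14 !e //.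
rewrite h11 ltnS (leq_eqVlt i) andbT.
case: eqP In => [->|_] /= In; last by rewrite !if_same.
by move=> _; rewrite leNgt; case: (0 < _) => //=; case: (0 <= _).
Qed.

End ProgramSpecs.

(** * Orthogonal projections *)

Section Euclidean.
Variable R : realType.

Lemma dotE n (u v : 'cV[R]_n) : dot u v = (u^T *m v) 0 0.
Proof. by rewrite mxE; apply: eq_bigr => i _; rewrite mxE. Qed.

Lemma dotC n (u v : 'cV[R]_n) : dot u v = dot v u.
Proof. by apply: eq_bigr => i _; rewrite mulrC. Qed.

Lemma dotDr n (u v w : 'cV[R]_n) : dot u (v + w) = dot u v + dot u w.
Proof. by rewrite !dotE mulmxDr mxE. Qed.

Lemma dotZr n a (u v : 'cV[R]_n) : dot u (a *: v) = a * dot u v.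
Proof. by rewrite !dotE -scalemxAr mxE. Qed.

Lemma dotDl n (u v w : 'cV[R]_n) : dot (v + w) u = dot v u + dot w u.
Proof. by rewrite dotC dotDr !(dotC u). Qed.

Lemma dotZl n a (u v : 'cV[R]_n) : dot (a *: v) u = a * dot v u.
Proof. by rewrite dotC dotZr dotC. Qed.

Lemma dot0r n (u : 'cV[R]_n) : dot u 0 = 0.
Proof. by rewrite dotE mulmx0 mxE. Qed.

Lemma dotNr n (u v : 'cV[R]_n) : dot u (- v) = - dot u v.
Proof. by rewrite -scaleN1r dotZr mulN1r. Qed.

Lemma dotNl n (u v : 'cV[R]_n) : dot (- v) u = - dot v u.
Proof. by rewrite dotC dotNr dotC. Qed.

Lemma dot_sumr n I (s : seq I) (P : pred I) (F : I -> 'cV[R]_n) u :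
  dot u (\sum_(i <- s | P i) F i) = \sum_(i <- s | P i) dot u (F i).
Proof.
by apply: (big_morph (dot u)) => [v w|]; rewrite ?dotDr ?dot0r.
Qed.

Lemma dot_mulmxl m n (M : 'M[R]_(m, n)) u v : dot (M *m u) v = dot u (M^T *m v).
Proof. by rewrite !dotE trmx_mul mulmxA. Qed.

Lemma dot_delta n (u : 'cV[R]_n) i : dot u (delta_mx i 0) = u i 0.
Proof.
rewrite /dot (bigD1 i) //= big1 ?addr0 => [|j /negPf ji];
  by rewrite mxE ?eqxx ?ji ?mulr1 ?mulr0.
Qed.

Lemma dot_ge0 n (u : 'cV[R]_n) : 0 <= dot u u.
Proof. by apply: sumr_ge0 => i _; rewrite -expr2 sqr_ge0. Qed.

Lemma dot_eq0 n (u : 'cV[R]_n) : (dot u u == 0) = (u == 0).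
Proof.
apply/idP/eqP => [|->]; last by rewrite dot0r.
rewrite psumr_eq0 => [/allP h|i _]; last by rewrite -expr2 sqr_ge0.
apply/colP => i; have := h i (mem_index_enum i).
by rewrite -expr2 sqrf_eq0 mxE => /eqP.
Qed.

Lemma norm2E n (u : 'cV[R]_n) : norm2 u = Num.sqrt (dot u u).
Proof. by congr Num.sqrt; apply: eq_bigr => i _; rewrite expr2. Qed.

Lemma norm2_ge0 n (u : 'cV[R]_n) : 0 <= norm2 u.
Proof. exact: sqrtr_ge0. Qed.

Lemma sqr_norm2 n (u : 'cV[R]_n) : norm2 u ^+ 2 = dot u u.
Proof. by rewrite norm2E sqr_sqrtr ?dot_ge0. Qed.

Lemma norm2_eq0 n (u : 'cV[R]_n) : (norm2 u == 0) = (u == 0).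
Proof. by rewrite -sqrf_eq0 sqr_norm2 dot_eq0. Qed.

Lemma norm2Z n a (u : 'cV[R]_n) : 0 <= a -> norm2 (a *: u) = a * norm2 u.
Proof.
move=> a0; rewrite !norm2E dotZl dotZr mulrA -expr2 sqrtrM ?sqr_ge0 //.
by rewrite sqrtr_sqr ger0_norm.
Qed.

Lemma cauchy_schwarz n (u v : 'cV[R]_n) : dot u v <= norm2 u * norm2 v.
Proof.
have [u0|u0] := eqVneq (norm2 u) 0.
  rewrite u0 mul0r; move/eqP: u0; rewrite norm2_eq0 => /eqP ->.
  by rewrite dotC dot0r.
have [v0|v0] := eqVneq (norm2 v) 0.
  rewrite v0 mulr0; move/eqP: v0; rewrite norm2_eq0 => /eqP ->.
  by rewrite dot0r.
have pos : 0 < norm2 u * norm2 v.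
  by apply: mulr_gt0; rewrite lt_neqAle eq_sym ?u0 ?v0 norm2_ge0.
(* This square expands to twice [|u| |v| (|u| |v| - <u, v>)], and the positive factor cancels. *)
have := dot_ge0 (norm2 v *: u - norm2 u *: v).
rewrite !(dotDl, dotDr, dotNl, dotNr, dotZl, dotZr) -!sqr_norm2 (dotC v u) => h.
have {}h : 0 <= norm2 u * norm2 v * (norm2 u * norm2 v - dot u v) by lra.
by rewrite -subr_ge0 -(pmulr_rge0 _ pos).
Qed.

Lemma norm2D n (u v : 'cV[R]_n) : norm2 (u + v) <= norm2 u + norm2 v.
Proof.
rewrite -(@ler_pXn2r _ 2) ?nnegrE ?addr_ge0 ?norm2_ge0 //.
rewrite sqr_norm2 dotDl !dotDr sqrrD !sqr_norm2 (dotC v u).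
by have := cauchy_schwarz u v; lra.
Qed.

Lemma norm2_sum n I (s : seq I) (P : pred I) (F : I -> 'cV[R]_n) :
  norm2 (\sum_(i <- s | P i) F i) <= \sum_(i <- s | P i) norm2 (F i).
Proof.
apply: (big_rec2 (fun (a : 'cV[R]_n) b => norm2 a <= b)) => [|i y x _ h].
  by rewrite norm2E dot0r sqrtr0.
by apply: le_trans (norm2D _ _) _; rewrite lerD2l.
Qed.

Lemma tmul_eq0 m n (M : 'M[R]_(m, n)) : M^T *m M = 0 -> M = 0.
Proof.
move=> h; apply/matrixP => i j.
have /eqP : dot (col j M) (col j M) = 0.
  have -> : 0 = (M^T *m M) j j by rewrite h mxE.
  rewrite mxE.
  by apply: eq_bigr => k _; rewrite !mxE.
by rewrite dot_eq0 => /eqP/colP/(_ i); rewrite !mxE.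
Qed.

End Euclidean.

Section Projection.
Variable R : realType.

Lemma moore_penrose_unique p q (M : 'M[R]_(p, q)) X Y :
  moore_penrose M X -> moore_penrose M Y -> X = Y.
Proof.
move=> [x1 x2 x3 x4] [y1 y2 y3 y4].
(* [M *m X] and [M *m Y] are symmetric and each absorbs the other, so transposing their product
   identifies them. *)
have xy : M *m X = M *m Y.
  have -> : M *m X = (M *m Y) *m (M *m X) by rewrite mulmxA y1.
  by rewrite -x3 -{1}y3 -trmx_mul mulmxA x1 y3.
have yx : X *m M = Y *m M.
  have -> : X *m M = (X *m M) *m (Y *m M) by rewrite -mulmxA (mulmxA M) y1.
  by rewrite -y4 -{1}x4 -trmx_mul -mulmxA (mulmxA M) x1 y4.
by rewrite -x2 -mulmxA xy mulmxA yx y2.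
Qed.

Lemma moore_penrose_tr p q (M : 'M[R]_(p, q)) X :
  moore_penrose M X -> moore_penrose M^T X^T.
Proof.
case=> [x1 x2 x3 x4]; split; rewrite -!trmx_mul ?mulmxA ?x1 ?x2 //.
  by rewrite !x4.
by rewrite !x3.
Qed.

Variables (m r : nat) (A : 'M[R]_(m, r)).

(** [pinv] is obtained by choice, so its symmetry comes from uniqueness: the transpose of a
    pseudoinverse of the symmetric matrix [A *m A^T] is another one. *)
Lemma QA_sym : (QA A)^T = QA A.
Proof.
have Gt : (A *m A^T)^T = A *m A^T by rewrite trmx_mul trmxK.
rewrite /QA !trmx_mul trmxK mulmxA; congr (_ *m _ *m _).
apply: moore_penrose_unique (pinvP _).
by rewrite -{1}Gt; apply: moore_penrose_tr (pinvP _).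
Qed.

Lemma QA_idem : QA A *m QA A = QA A.
Proof.
have [_ h2 _ _] := pinvP (A *m A^T).
by rewrite /QA -{3}h2 !mulmxA.
Qed.

(** [A *m A^T] may be singular, so nothing is inverted. The defect [E] satisfies [E *m E^T = 0] by
    the first Penrose equation, hence vanishes. *)
Lemma mulmx_QA : A *m QA A = A.
Proof.
have [h1 h2 h3 h4] := pinvP (A *m A^T).
rewrite /QA; set X := pinv _ in h1 h2 h3 h4 *.
pose E := (A *m A^T *m X - 1%:M) *m A.
have E0 : E^T = 0.
  apply: tmul_eq0; rewrite trmxK /E trmx_mul mulmxA -(mulmxA _ A).
  by rewrite mulmxBl mul1mx h1 subrr mul0mx.
move: E0 => /(congr1 trmx); rewrite trmxK trmx0 /E mulmxBl mul1mx => /eqP.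
by rewrite subr_eq0 !mulmxA => /eqP.
Qed.

(** In a full-rank factorization [S = C F], idempotence cancels to [F C = 1], whose trace is the
    rank. *)
Lemma proj_mxtrace (S : 'M[R]_r) : S *m S = S -> \tr S = (\rank S)%:R.
Proof.
move=> SS; have E : row_base S *m col_base S = 1%:M.
  have := SS; rewrite -{1 2 3}(mulmx_base S) mulmxA -(mulmxA (col_base S)) => h.
  apply: (row_full_inj (col_base_full S)).
  apply: (row_free_inj (row_base_free S)).
  by rewrite mulmx1.
by rewrite -{1}(mulmx_base S) mxtrace_mulC E mxtrace1.
Qed.

Lemma mxtrace_QA : \tr (QA A) <= m%:R.
Proof.
rewrite proj_mxtrace ?QA_idem // ler_nat /QA.
by rewrite (leq_trans (mxrankM_maxr _ _)) // rank_leq_row.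
Qed.

End Projection.

(** * Gordan's theorem and the condition number *)

Section Gordan.
Variables (R : realType) (m : nat).

(** Adding [b] to a large multiple of [u] makes the product with [b] strictly positive. [K] exceeds
    each ratio of [|<b, a_i>|] to [<u, a_i>], so the other products keep their sign. *)
Lemma gordan_perturb r (a : 'I_r -> 'cV[R]_m) (b u : 'cV[R]_m) :
  b != 0 -> 0 <= dot u b -> (forall i, 0 < dot u (a i)) ->
  exists w, 0 < dot w b /\ forall i, 0 < dot w (a i).
Proof.
move=> b0 ub ua.
pose K := \sum_i `|dot b (a i)| / dot u (a i) + 1.
have Ki i : `|dot b (a i)| / dot u (a i) <= \sum_i `|dot b (a i)| / dot u (a i).
  rewrite (bigD1 i) //= lerDl; apply: sumr_ge0 => j _.
  by rewrite divr_ge0 // ltW.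
have K0 : 0 <= K.
  by rewrite addr_ge0 //; apply: sumr_ge0 => i _; rewrite divr_ge0 // ltW.
exists (K *: u + b); split=> [|i]; rewrite dotDl dotZl.
  by rewrite ltr_wpDl ?mulr_ge0 // lt_neqAle eq_sym dot_eq0 b0 dot_ge0.
have : `|dot b (a i)| < K * dot u (a i).
  by rewrite -ltr_pdivrMr // (le_lt_trans (Ki i)) // /K ltrDl.
by have := ler_norm (- dot b (a i)); rewrite normrN; lra.
Qed.

(* Induction on the number of columns: if u is positive on all columns but b,
   the remaining columns are projected along b onto the hyperplane u = 0. *)
Theorem gordan r (a : 'I_r -> 'cV[R]_m) :
  (exists u, forall i, 0 < dot u (a i)) \/
  (exists x : 'I_r -> R, [/\ forall i, 0 <= x i, exists i, x i != 0
     & \sum_i x i *: a i = 0]).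
Proof.
elim: r a => [a|r IH a]; first by left; exists 0; case.
pose b := a ord0; pose a' i := a (lift ord0 i).
pose ext y (x : 'I_r -> R) i := if unlift ord0 i is Some j then x j else y.
have ext0 y x : ext y x ord0 = y by rewrite /ext unlift_none.
have extS y x j : ext y x (lift ord0 j) = x j by rewrite /ext liftK.
have dep y x : 0 <= y -> (forall i, 0 <= x i) ->
    (y != 0 \/ exists i, x i != 0) -> y *: b + \sum_i x i *: a' i = 0 ->
    exists x : 'I_r.+1 -> R, [/\ forall i, 0 <= x i, exists i, x i != 0
      & \sum_i x i *: a i = 0].
  move=> y0 x0 nz E; exists (ext y x); split.
  - by move=> i; rewrite /ext; case: unlift.
  - case: nz => [y1|[i xi]]; first by exists ord0; rewrite ext0.
    by exists (lift ord0 i); rewrite extS.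
  - rewrite big_ord_recl ext0 -[RHS]E; congr (_ + _).
    by apply: eq_bigr => i _; rewrite extS.
(* If [b] is zero it is a dependency by itself; otherwise the perturbation makes a weak inequality
   on [b] strict. *)
suff : b != 0 -> (exists u, 0 <= dot u b /\ forall i, 0 < dot u (a' i)) \/
    exists y x, [/\ 0 <= y, forall i, 0 <= x i, exists i, x i != 0
      & y *: b + \sum_i x i *: a' i = 0].
  have [b0 _|b0 /(_ isT)[[u [ub ua]]|[y [x [y0 x0 nz E]]]]] := eqVneq b 0.
  - right; apply: (dep 1 (fun=> 0)) => //; first by left; rewrite oner_eq0.
    by rewrite scale1r b0 big1 ?addr0 // => i _; rewrite scale0r.
  - left; have [w [wb wa]] := gordan_perturb b0 ub ua.
    exists w => i; case: (unliftP ord0 i) => [j|] ->; [exact: wa|exact: wb].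
  - by right; apply: (dep y x) => //; right.
move=> b0; case: (IH a') => [[u ua]|[x [x0 nz E]]]; last first.
  by right; exists 0, x; split=> //; rewrite scale0r add0r.
have [ub|ub] := leP 0 (dot u b); first by left; exists u.
(* With this weight [a' i + l i *: b] is orthogonal to [u]. The weight is nonnegative, so a
   dependency among the projected columns lifts to a nonnegative one that includes [b]. *)
pose l i := dot u (a' i) / - dot u b.
have l0 i : 0 <= l i by rewrite divr_ge0 ?oppr_ge0 // ltW.
case: (IH (fun i => a' i + l i *: b)) => [[w wa]|[x [x0 nz E]]].
  (* This multiple of [u] makes the product with [b] zero, and the product with [a' i] becomes that
     of [w] with the projected column. *)
  left; exists (w + (dot w b / - dot u b) *: u); split=> [|i].
    by rewrite dotDl dotZl invrN mulrN mulNr divfK ?lt_eqF // subrr.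
  have := wa i; rewrite dotDr dotZr dotDl dotZl /l.
  by rewrite mulrAC [X in _ -> 0 < _ + X]mulrAC (mulrC (dot u _)).
right; exists (\sum_i x i * l i), x; split=> //.
  by apply: sumr_ge0 => i _; rewrite mulr_ge0.
rewrite -[RHS]E scaler_suml -big_split; apply: eq_bigr => i _ /=.
by rewrite scalerDr scalerA addrC.
Qed.

End Gordan.

(** * Bounds for the condition number *)

Section Rho.
Variable R : realType.
Local Open Scope classical_set_scope.

Lemma inf_range_min r (f : 'I_r -> R) : (0 < r)%N ->
  exists2 i, inf [set f i | i in [set: 'I_r]] = f i & forall j, f i <= f j.
Proof.
move=> r0; case: (arg_minP f (isT : xpredT (Ordinal r0))) => i _ mini.
exists i => [|j]; last exact: mini.
have lb : lbound [set f i | i in [set: 'I_r]] (f i).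
  by move=> _ [j _ <-]; exact: mini.
apply/eqP; rewrite eq_le; apply/andP; split.
  by apply: ge_inf; [exists (f i)|exists i].
by apply: lb_le_inf => //; exists (f i), i.
Qed.

Section Bounds.
Variables (p r : nat) (Q : 'M[R]_(p, r)).
Hypothesis r0 : (0 < r)%N.

Let margins := [set inf [set dot x ((norm2 (col i Q))^-1 *: col i Q)
  | i in [set: 'I_r]] | x in [set x : 'cV[R]_p | norm2 x = 1]].

Let margins_ub : ubound margins 1.
Proof.
move=> _ [x /= x1 <-].
have [i -> _] := inf_range_min
  (fun i => dot x ((norm2 (col i Q))^-1 *: col i Q)) r0.
apply: le_trans (cauchy_schwarz _ _) _.
rewrite x1 mul1r norm2Z ?invr_ge0 ?norm2_ge0 //.
have [->|n0] := eqVneq (norm2 (col i Q)) 0; first by rewrite mulr0.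
by rewrite mulVf.
Qed.

Lemma rho_ge x d : norm2 x = 1 ->
  (forall i, d <= dot x ((norm2 (col i Q))^-1 *: col i Q)) -> d <= rho Q.
Proof.
move=> x1 dx.
have [i E _] := inf_range_min
  (fun i => dot x ((norm2 (col i Q))^-1 *: col i Q)) r0.
apply: le_trans (dx i) _; rewrite -E.
by apply: ub_le_sup; [exists 1|exists x].
Qed.

Lemma rho_le d : (0 < p)%N ->
  (forall x, norm2 x = 1 ->
    exists i, dot x ((norm2 (col i Q))^-1 *: col i Q) <= d) -> rho Q <= d.
Proof.
move=> p0 h; apply: ge_sup.
  exists (inf [set dot (delta_mx (Ordinal p0) 0)
    ((norm2 (col i Q))^-1 *: col i Q) | i in [set: 'I_r]]).
  exists (delta_mx (Ordinal p0) 0) => //=.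
  by rewrite norm2E dot_delta mxE !eqxx sqrtr1.
move=> _ [x /= x1 <-].
have [i -> mini] := inf_range_min
  (fun i => dot x ((norm2 (col i Q))^-1 *: col i Q)) r0.
by have [j hj] := h x x1; apply: le_trans (mini j) hj.
Qed.

(** Positivity excludes the empty set of margins, whose [sup] is 0 by default. *)
Lemma rho_le1 : 0 < rho Q -> rho Q <= 1.
Proof.
move=> rho0; apply: ge_sup margins_ub.
have [//|/nonemptyPn E] := pselect (margins !=set0).
by move: rho0; rewrite /rho -/margins E sup0 ltxx.
Qed.

(** Approximating the supremum avoids proving that it is attained, at the price of [d < rho Q].
    Multiplying by the column norm makes the inequality meaningful for zero columns too. *)
Lemma rho_witness d : d < rho Q -> 0 < rho Q ->
  exists2 x, norm2 x = 1 & forall i, d * norm2 (col i Q) <= dot x (col i Q).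
Proof.
move=> d_rho rho0.
have hs : has_sup margins.
  split; last by exists 1; exact: margins_ub.
  have [//|/nonemptyPn E] := pselect (margins !=set0).
  by move: rho0; rewrite /rho -/margins E sup0 ltxx.
have e0 : 0 < rho Q - d by rewrite subr_gt0.
have [_ [x /= x1 <-]] := sup_adherent e0 hs.
rewrite -/(rho Q) opprB addrC subrK => dx; exists x => // i.
have [j E mini] := inf_range_min
  (fun i => dot x ((norm2 (col i Q))^-1 *: col i Q)) r0.
have := lt_le_trans dx (eq_ind_r (fun z => z <= _) (mini i) E).
have [n0 _|n0] := eqVneq (norm2 (col i Q)) 0.
  rewrite n0 mulr0; move/eqP: n0; rewrite norm2_eq0 => /eqP ->.
  by rewrite dot0r.
rewrite dotZr mulrC ltr_pdivlMr; first exact: ltW.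
by rewrite lt_neqAle eq_sym n0 norm2_ge0.
Qed.

End Bounds.

Lemma rho_QA_gt0 m r (A : 'M[R]_(m, r)) :
  (0 < r)%N -> primal_infeasible A -> 0 < rho (QA A).
Proof.
move=> r0 inf; case: (gordan (fun i => col i A)) => [[u ua]|[x [x0 [i xi] E]]].
  (* [A^T *m u] lies in the range of the projection, so its product with column [i] of [QA A] is its
     own entry [i], which is [<u, a_i> > 0]. Its normalization has positive margin. *)
  pose v := A^T *m u.
  have vi i : v i 0 = dot u (col i A).
    by rewrite mxE; apply: eq_bigr => k _; rewrite !mxE mulrC.
  have vq i : dot v (col i (QA A)) = v i 0.
    have QAt : QA A *m A^T = A^T.
      by rewrite -[in LHS]QA_sym -trmx_mul mulmx_QA.
    rewrite colE dotC dot_mulmxl QA_sym /v mulmxA QAt.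
    by rewrite dotC dot_delta.
  have v0 : 0 < norm2 v.
    rewrite lt_neqAle norm2_ge0 eq_sym norm2_eq0 andbT.
    apply/eqP => /colP/(_ (Ordinal r0)); rewrite vi mxE => E.
    by have := ua (Ordinal r0); rewrite E ltxx.
  pose x := (norm2 v)^-1 *: v.
  pose f i := dot x ((norm2 (col i (QA A)))^-1 *: col i (QA A)).
  have f0 i : 0 < f i.
    rewrite /f dotZl dotZr vq !mulr_gt0 ?invr_gt0 ?vi //.
    rewrite lt_neqAle norm2_ge0 eq_sym norm2_eq0 andbT.
    apply/eqP => E; have := vq i; rewrite E dot0r vi => E'.
    by have := ua i; rewrite -E' ltxx.
  have [i _ mini] := inf_range_min f r0.
  apply: lt_le_trans (f0 i) _; apply: (rho_ge r0 (x := x)) => //.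
  by rewrite norm2Z ?invr_ge0 ?norm2_ge0 // mulVf ?gt_eqF.
(* Dividing the nonnegative dependency by the sum of its coefficients brings it into the unit
   cube. *)
case: inf; pose S := \sum_j x j.
have xS j : x j <= S.
  by rewrite /S (bigD1 j) //= lerDl; apply: sumr_ge0.
have S0 : 0 < S by apply: lt_le_trans (xS i); rewrite lt_neqAle eq_sym xi x0.
exists (\col_j (x j / S)); split.
- apply/colP => k; have /colP/(_ k) := E; rewrite !mxE summxE => E'.
  transitivity (0 / S); last by rewrite mul0r.
  rewrite -[in RHS]E' mulr_suml; apply: eq_bigr => j _.
  by rewrite !mxE mulrA (mulrC (A k j)).
- by move=> j; rewrite mxE divr_ge0 ?(ltW S0) //= ler_pdivrMr // mul1r.
- move/colP/(_ i); rewrite !mxE => /eqP; rewrite mulf_eq0 invr_eq0.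
  by rewrite (negPf xi) gt_eqF.
Qed.

Lemma rho_QA1 n : (0 < n)%N -> rho (QA (1%:M : 'M[R]_n)) = (Num.sqrt n%:R)^-1.
Proof.
move=> n0; have -> : QA (1%:M : 'M[R]_n) = 1%:M.
  by rewrite -[LHS]mul1mx mulmx_QA.
have colx i : (norm2 (col i (1%:M : 'M[R]_n)))^-1 *: col i 1%:M = delta_mx i 0.
  have -> : col i 1%:M = delta_mx i 0 :> 'cV[R]_n by rewrite colE mul1mx.
  by rewrite norm2E dot_delta mxE !eqxx sqrtr1 invr1 scale1r.
have nR : 0 < n%:R :> R by rewrite ltr0n.
apply/eqP; rewrite eq_le; apply/andP; split.
  apply: rho_le => // x x1; apply/existsP; apply: contraT.
  rewrite negb_exists => /forallP h.
  (* If every coordinate exceeded [1 / sqrt n], the squares would sum to more than 1. The constant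
     vector attains this value below. *)
  have : dot x x = 1 by rewrite -sqr_norm2 x1 expr1n.
  suff : 1 < dot x x by move=> /[swap] ->; rewrite ltxx.
  have {1}-> : 1 = \sum_(i < n) (n%:R^-1 : R).
    by rewrite sumr_const card_ord -[_ *+ n]mulr_natr mulVf ?gt_eqF.
  apply: ltr_sum => [|i _]; first by apply/hasP; exists (Ordinal n0).
  have := h i; rewrite colx dot_delta -ltNge => hi.
  rewrite -expr2 -[X in X^-1]sqr_sqrtr ?ltW // -exprVn.
  rewrite ltr_pXn2r ?nnegrE ?invr_ge0 ?sqrtr_ge0 //.
  by rewrite ltW // (le_lt_trans _ hi) // invr_ge0 sqrtr_ge0.
apply: (rho_ge n0 (x := const_mx (Num.sqrt n%:R)^-1)) => [|i].
  rewrite norm2E /dot (eq_bigr (fun=> n%:R^-1)) => [|i _]; last first.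
    by rewrite !mxE -expr2 exprVn sqr_sqrtr // ltW.
  by rewrite sumr_const card_ord -[_ *+ n]mulr_natr mulVf ?gt_eqF // sqrtr1.
by rewrite colx dot_delta mxE.
Qed.

End Rho.

(** * The iterates *)

Section Iterates.
Variables (R : realType) (r : nat) (Q : 'M[R]_r).
Hypotheses (r0 : (0 < r)%N) (Q_sym : Q^T = Q) (Q_idem : Q *m Q = Q).
Implicit Types (v y x : 'cV[R]_r).

Let rR : 0 < r%:R :> R. Proof. by rewrite ltr0n. Qed.

Lemma sumKE v i : sumK v i 0 = (v i 0 <= 0)%R%:R.
Proof.
rewrite summxE big_mkcond (bigD1 i) //= big1 ?addr0 => [|j /negPf ji].
  by case: ifP; rewrite // mxE !eqxx.
by case: ifP; rewrite // mxE eq_sym ji.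
Qed.

Lemma dot_sumK v u : dot u (sumK v) = \sum_(k | v k 0 <= 0) u k 0.
Proof. by rewrite dot_sumr; apply: eq_bigr => k _; rewrite dot_delta. Qed.

Lemma dot_qK v x : dot (qK Q v) x = \sum_(k | v k 0 <= 0) (Q *m x) k 0.
Proof. by rewrite dot_mulmxl Q_sym dotC dot_sumK. Qed.

Lemma dot_qK_le0 v : Q *m v = v -> dot (qK Q v) v <= 0.
Proof. by move=> Qv; rewrite dot_qK Qv; apply: sumr_le0. Qed.

Lemma norm2_proj x : norm2 (Q *m x) <= norm2 x.
Proof.
rewrite -(@ler_pXn2r _ 2) ?nnegrE ?norm2_ge0 // !sqr_norm2.
(* Pythagoras: this square equals [|x|^2 - |Q x|^2]. *)
have := dot_ge0 (x - Q *m x); rewrite !(dotDl, dotDr, dotNl, dotNr).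
have -> : dot x (Q *m x) = dot (Q *m x) (Q *m x).
  by rewrite [RHS]dot_mulmxl Q_sym mulmxA Q_idem.
by rewrite (dotC _ x) [dot x (Q *m x)](_ : _ = dot (Q *m x) (Q *m x)); [lra|
  rewrite [RHS]dot_mulmxl Q_sym mulmxA Q_idem].
Qed.

Lemma dot_sumK_le v : dot (sumK v) (sumK v) <= r%:R.
Proof.
rewrite -[X in _ <= X%:R]card_ord -sumr_const; apply: ler_sum => i _.
by rewrite sumKE; case: (v i 0 <= 0); rewrite ?mulr1 ?mulr0.
Qed.

Lemma norm2_qK_le v : norm2 (qK Q v) <= Num.sqrt r%:R.
Proof.
apply: le_trans (norm2_proj _) _; rewrite norm2E.
by apply: ler_wsqrtr; exact: dot_sumK_le.
Qed.

Lemma threshold_gt0 : 0 < threshold R r.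
Proof. by rewrite invr_gt0 mulr_gt0 // sqrtr_gt0 exprn_gt0. Qed.

Lemma sqr_threshold : threshold R r ^+ 2 = (4 * r%:R ^+ 3)^-1.
Proof.
rewrite exprVn exprMn sqr_sqrtr ?exprn_ge0 ?ltW //.
by congr ((_ * _)^-1); ring.
Qed.

Lemma threshold_sqrt : threshold R r * Num.sqrt r%:R = (2 * r%:R)^-1.
Proof.
have s0 : 0 < Num.sqrt (r%:R : R) by rewrite sqrtr_gt0.
rewrite /threshold (exprS _ 2) sqrtrM ?ltW // sqrtr_sqr ger0_norm ?ltW //.
by field; rewrite !gt_eqF.
Qed.

(** Both [alpha] and [- threshold] are nonpositive, so squaring loses nothing. The condition [0 < w]
    excludes [q_K = 0], where [alpha] is 0 and lies above [- threshold]. *)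
Lemma alpha_le_thresholdP v : Q *m v = v ->
  let s := dot (qK Q v) v in let w := dot (qK Q v) (qK Q v) in
  (alpha Q v <= - threshold R r) = (0 < w <= 4 * r%:R ^+ 3 * s * s).
Proof.
move=> Qv s w; rewrite /alpha -dot_eq0 -/w.
have th := threshold_gt0.
have w_ge0 : 0 <= w by exact: dot_ge0.
have [->|w0] := eqVneq w 0; first by rewrite ltxx oppr_ge0 leNgt th.
have wgt : 0 < w by rewrite lt_neqAle eq_sym w0.
rewrite wgt dotZl -/s /=.
have s0 : s <= 0 by exact: dot_qK_le0.
have n0 : 0 < norm2 (qK Q v).
  by rewrite lt_neqAle norm2_ge0 eq_sym norm2_eq0 -dot_eq0 w0.
rewrite lerNr -mulrN -(@ler_pXn2r _ 2) ?nnegrE ?(ltW th) //; last first.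
  by rewrite mulr_ge0 ?oppr_ge0 // invr_ge0 norm2_ge0.
rewrite sqr_threshold exprMn exprVn sqr_norm2 -/w sqrrN.
have r3 : 0 < 4 * r%:R ^+ 3 :> R by rewrite mulr_gt0 ?exprn_gt0.
by rewrite ler_pdivlMl // ler_pdivrMr // mulrC expr2 mulrA.
Qed.

Lemma cut_exists v y : Q *m v = v -> (forall i, r%:R^-1 <= y i 0) ->
  ~ (forall i, 0 < (y - v) i 0) -> ~ alpha Q v <= - threshold R r ->
  exists j, (0 < v j 0) && (0 <= v j 0 + (dot (qK Q v) v + dot (qK Q v) v)).
Proof.
move=> Qv yr /existsNP[j /negP]; rewrite -leNgt !mxE subr_le0 => vj /negP.
rewrite -ltNge => al; exists j.
have ri : 0 < r%:R^-1 :> R by rewrite invr_gt0.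
have vr : r%:R^-1 <= v j 0 by apply: le_trans (yr j) vj.
rewrite (lt_le_trans ri vr) /=.
suff : - (2 * r%:R)^-1 <= dot (qK Q v) v by rewrite invfM; lra.
move: al; rewrite /alpha; case: eqP => [->|/eqP q0].
  by rewrite dotC dot0r oppr_le0 invr_ge0 mulr_ge0 ?ltW.
have n0 : 0 < norm2 (qK Q v) by rewrite lt_neqAle norm2_ge0 eq_sym norm2_eq0 q0.
rewrite dotZl mulrC ltr_pdivlMr // => h; apply: le_trans (ltW h).
rewrite mulNr lerN2 -threshold_sqrt ler_pM2l ?threshold_gt0 //.
exact: norm2_qK_le.
Qed.

(** As [v_j] is positive, the positive parts in the bound come from the nonpositive entries of [v]
    alone, and these sum to [<q_K, v>]. *)
Lemma cut_bound v j : Q *m v = v ->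
  (0 < v j 0) && (0 <= v j 0 + (dot (qK Q v) v + dot (qK Q v) v)) ->
  v j 0 != 0 /\ bound v j <= 2^-1.
Proof.
move=> Qv /andP[vj h]; split; first by rewrite gt_eqF.
have -> : bound v j = - dot (qK Q v) v / v j 0.
  rewrite dot_qK Qv [in RHS]big_mkcond -sumrN mulr_suml; apply: eq_bigr => i _.
  rewrite invrN mulrN; case: (leP (v i 0) 0) => vi.
    by rewrite mulNr max_r // oppr_ge0 mulr_le0_ge0 // invr_ge0 ltW.
  by rewrite oppr0 mul0r max_l // oppr_le0 divr_ge0 // ltW.
by rewrite ler_pdivrMr //; lra.
Qed.

(** [alpha] already contains one inverse norm, so the step length is a quotient of inner products
    without square roots; for [q_K = 0] both sides are 0 by convention. *)
Lemma alpha_div v : alpha Q v / norm2 (qK Q v) =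
  dot (qK Q v) v / dot (qK Q v) (qK Q v).
Proof.
rewrite /alpha; case: eqP => [->|_]; first by rewrite !(dotC 0) !dot0r !mul0r.
by rewrite dotZl -sqr_norm2 mulrAC mulrC expr2 invfM mulrA.
Qed.

Variables (c : R) (n : nat).
Hypothesis c02 : 0 < c < 2.

(** The cases exclude one another, and only the choice of [J] is free within them. This ties the
    machine's own outcome to a prescribed run. *)
Lemma bp_iter_continue y v y' v' o :
  bp_iter c n Q y v (Continue y' v') -> bp_iter c n Q y v o ->
  o = Continue y' v'.
Proof.
move E : (Continue y' v') => o' H; case: H E => // h1 h2 h3 _.
by case.
Qed.

Lemma bp_iter_continueP y v y' v' : bp_iter c n Q y v (Continue y' v') ->
  [/\ alpha Q v <= - threshold R r,
   y' = y - (c * (alpha Q v / norm2 (qK Q v))) *: sumK v &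
   v' = v - (c * (alpha Q v / norm2 (qK Q v))) *: qK Q v].
Proof.
by move E : (Continue y' v') => o' H; case: H E => // h1 h2 h3 [-> ->].
Qed.

Lemma bp_reaches_inv t y v : bp_reaches c n Q t y v ->
  [/\ forall i, r%:R^-1 <= y i 0, v = Q *m y & norm2 v <= norm2 (Q *m y0 R r)].
Proof.
have [c0 c2] := andP c02.
elim=> [|{}t {}y {}v y' v' _ [yr vy nv] /bp_iter_continueP[al -> ->]].
  by split=> // i; rewrite mxE.
have Qv : Q *m v = v by rewrite vy mulmxA Q_idem.
have := al; rewrite alpha_le_thresholdP // alpha_div.
have := dot_qK_le0 Qv.
set s := dot _ _; set w := dot _ _ => s0 /andP[w0 _]; split=> [i||].
- apply: le_trans (yr i) _; rewrite !mxE sumKE lerDl oppr_ge0.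
  rewrite mulr_le0_ge0 ?ler0n // mulr_ge0_le0 ?(ltW c0) //.
  by rewrite mulr_le0_ge0 // invr_ge0 (ltW w0).
- by rewrite mulmxBr -scalemxAr -vy.
- apply: le_trans nv; rewrite -(@ler_pXn2r _ 2) ?nnegrE ?norm2_ge0 //.
  rewrite !sqr_norm2 !(dotDl, dotDr, dotNl, dotNr, dotZl, dotZr).
  rewrite (dotC v) -/s -/w.
  (* The exact drop of [|v|^2] in an update; its sign is where the range [0 < c < 2] of the step
     size enters. *)
  rewrite -subr_ge0 (_ : _ - _ = c * (2 - c) * (s ^+ 2 / w)); last first.
    by field; rewrite gt_eqF.
  rewrite mulr_ge0 ?divr_ge0 ?sqr_ge0 ?(ltW w0) //.
  by rewrite mulr_ge0 ?subr_ge0 ?(ltW c0) ?(ltW c2).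
Qed.

(* The inner product with x grows linearly while the norm of v does not. *)
Lemma bp_reaches_bound x d t y v : norm2 x = 1 -> 0 < d ->
  (forall i, d * norm2 (col i Q) <= dot x (col i Q)) ->
  bp_reaches c n Q t y v -> t%:R * (c * d) <= 2 * r%:R.
Proof.
have [c0 c2] := andP c02.
move=> x1 d0 xq H; have th := threshold_gt0.
have colQ k : Q *m delta_mx k 0 = col k Q by rewrite colE.
have growth : t%:R * (c * d * threshold R r) <= dot x v.
  elim: H => [|{}t {}y {}v y' v' Hr IH /bp_iter_continueP[al _ ->]].
    (* Initially [Q y0] is a nonnegative combination of columns, each having nonnegative product
       with [x]. *)
    rewrite mul0r; have -> : y0 R r = \sum_i r%:R^-1 *: delta_mx i 0.
      apply/colP => i; rewrite summxE (bigD1 i) //= big1 => [|j /negPf ji].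
        by rewrite !mxE !eqxx mulr1 addr0.
      by rewrite !mxE eq_sym ji mulr0.
    rewrite mulmx_sumr dot_sumr; apply: sumr_ge0 => i _.
    rewrite -scalemxAr dotZr colQ mulr_ge0 ?invr_ge0 ?(ltW rR) //.
    by apply: le_trans (xq i); rewrite mulr_ge0 ?norm2_ge0 ?(ltW d0).
  have q0 : qK Q v != 0.
    by apply: contraTneq al => q0; rewrite /alpha q0 eqxx oppr_ge0 -ltNge.
  have n0 : 0 < norm2 (qK Q v).
    by rewrite lt_neqAle norm2_ge0 eq_sym norm2_eq0 q0.
  have xqK : d * norm2 (qK Q v) <= dot x (qK Q v).
    rewrite /qK /sumK mulmx_sumr dot_sumr.
    apply: (@le_trans _ _
      (d * \sum_(k | v k 0 <= 0) norm2 (Q *m delta_mx k 0))).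
      by rewrite ler_pM2l ?norm2_sum.
    by rewrite mulr_sumr; apply: ler_sum => k _; rewrite colQ.
  rewrite dotDr dotNr dotZr -natr1 mulrDl mul1r lerD //.
  have -> : - (c * (alpha Q v / norm2 (qK Q v)) * dot x (qK Q v)) =
      c * (dot x (qK Q v) / norm2 (qK Q v)) * (- alpha Q v).
    by field; rewrite gt_eqF.
  apply: ler_pM.
  - exact: mulr_ge0 (ltW c0) (ltW d0).
  - exact: ltW.
  - by rewrite ler_pM2l // ler_pdivlMr.
  - by rewrite lerNr.
have [_ _ nv] := bp_reaches_inv H.
have ny0 : norm2 (y0 R r) = (Num.sqrt r%:R)^-1.
  rewrite norm2E /dot (eq_bigr (fun=> r%:R^-1 ^+ 2)) => [|i _]; last first.
    by rewrite !mxE expr2.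
  rewrite sumr_const card_ord -[_ *+ r]mulr_natr expr2 mulfVK ?gt_eqF //.
  by rewrite sqrtrV // ltW.
have h : t%:R * (c * d * threshold R r) <= (Num.sqrt r%:R)^-1.
  apply: le_trans growth _; apply: le_trans (cauchy_schwarz _ _) _.
  by rewrite x1 mul1r -ny0; apply: le_trans nv (norm2_proj _).
have s0 : 0 < Num.sqrt (r%:R : R) by rewrite sqrtr_gt0.
(* Multiplying by [sqrt r] turns the threshold into [1 / (2 r)], whence the bound [2 r]. *)
move: h; rewrite -(ler_pM2r s0) mulVf ?gt_eqF //.
rewrite [X in X <= _](_ : _ = t%:R * (c * d) * (threshold R r * Num.sqrt r%:R)).
  rewrite threshold_sqrt.
  by rewrite ler_pdivrMr ?mulr_gt0 // mul1r.
by ring.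
Qed.

End Iterates.

(** * Correctness and running time of the program *)

Section Deflation.
Variables (R : realType) (r : nat) (S : 'M[R]_r) (j : 'I_r).
Hypotheses (S_sym : S^T = S) (S_idem : S *m S = S).

(* As S j j = |S e_j|^2, this is the projection onto the line of S e_j, which
   lies in the range of S; hence S - deflated is again a projection. *)
Definition deflated : 'M[R]_r :=
  \matrix_(i, l) (S i j * (S l j / S j j)).

Let symE a b : S a b = S b a. Proof. by rewrite -[in LHS]S_sym mxE. Qed.

Let diagE : S j j = dot (col j S) (col j S).
Proof.
by rewrite -[in LHS]S_idem mxE; apply: eq_bigr => l _; rewrite !mxE symE.
Qed.

Lemma proj_diag_le0 : S j j <= 0 -> forall l, S l j = 0.
Proof.
rewrite diagE => h l.
have /eqP : dot (col j S) (col j S) = 0 by apply/eqP; rewrite eq_le h dot_ge0.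
by rewrite dot_eq0 => /eqP/colP/(_ l); rewrite !mxE.
Qed.

Lemma deflate_sym : (S - deflated)^T = S - deflated.
Proof. by apply/matrixP => a b; rewrite !mxE (symE b a); ring. Qed.

Hypothesis d0 : S j j != 0.

Let deflatedE : deflated = (S j j)^-1 *: (col j S *m (col j S)^T).
Proof. by apply/matrixP => a b; rewrite !mxE big_ord1 !mxE; ring. Qed.

(** The vector [S e_j] is fixed by [S] and has squared norm [S j j], so both cross products and the
    square of [deflated] equal [deflated]. *)
Lemma deflate_idem : (S - deflated) *m (S - deflated) = S - deflated.
Proof.
have Su : S *m col j S = col j S by rewrite colE mulmxA S_idem.
have uS : (col j S)^T *m S = (col j S)^T.
  by rewrite -{2}S_sym -trmx_mul Su.
have uu : (col j S)^T *m col j S = (S j j)%:M.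
  by apply/matrixP => a b; rewrite !ord1 -dotE -diagE mxE.
rewrite deflatedE mulmxBl !mulmxBr S_idem -!scalemxAr -!scalemxAl mulmxA Su.
rewrite -!mulmxA uS (mulmxA _ (col j S)) uu mul_scalar_mx -scalemxAr scalerA.
by rewrite scalerA mulfVK // subrr subr0.
Qed.

Lemma mxtrace_deflate : \tr (S - deflated) = \tr S - 1.
Proof.
rewrite raddfB /= deflatedE mxtraceZ mxtrace_mulC.
rewrite /mxtrace [in X in _ * X]big_ord1 -dotE -diagE mulVf //.
Qed.

End Deflation.

(** * Factorization of a projection by Gram-Schmidt *)

Section Preprocessing.
Variables (R : realType) (r : nat).

Definition factors (Q : 'M[R]_r) (s : state R) : Prop :=
  forall i l : 'I_r, Q i l = \sum_(t < reg s 2) smem s 7 t i * smem s 8 t l.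

Lemma gram_schmidt_spec (Q : 'M[R]_r) s : Q^T = Q -> Q *m Q = Q ->
  reg s 1 = r -> reg s 2 = 0%N -> smem s 11 0 0 = 0 ->
  (forall i l : 'I_r, smem s 0 i l = Q i l) ->
  let s' := exec gram_schmidt s in
  [/\ factors Q s', (reg s' 2)%:R = \tr Q &
      (time s' <= time s + 1 + r * 2 + reg s' 2 * cost (reg s) pivot)%N].
Proof.
move=> Qt QQ r1 r2 z0 hQ.
(* [S] is the residual projection, with its first [n] columns cleared; each stored row accounts for
   one unit of trace. The time belongs to the invariant because [exec_cost] would charge a pivot to
   all [r] passes, while only as many passes pivot as the trace says. *)
pose I n z := exists S : 'M[R]_r,
  [/\ S^T = S, S *m S = S, forall i l : 'I_r, smem z 0 i l = S i l,
      forall i : 'I_r, (i < n)%N -> forall l, S l i = 0 &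
   [/\ forall i l : 'I_r,
        Q i l = S i l + \sum_(t < reg z 2) smem z 7 t i * smem z 8 t l,
      \tr Q = \tr S + (reg z 2)%:R &
      (time z <= time s + 1 + n * 2 + reg z 2 * cost (reg s) pivot)%N]].
suff : I r (exec gram_schmidt s).
  case=> S [_ _ _ S0 [QE trE ht]].
  have {}S0 : S = 0 by apply/matrixP => i l; rewrite S0 // mxE.
  split=> //; last by rewrite trE S0 mxtrace0 add0r.
  by move=> i l; rewrite QE S0 mxE add0r.
rewrite -{1}r1 /gram_schmidt; apply: (@exec_for _ I) => [|n z].
  exists Q; split=> //; split; rewrite /= ?r2 ?addr0 //; last by lia.
  by move=> i l; rewrite big_ord0 addr0.
rewrite r1 => nr fm fr [S [St SS hS S0 [QE trE ht]]].
pose j := Ordinal nr.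
set z1 := tick (write_reg z 3 n).
have -> : exec (IfLe (entry2 0 3 3) (scal 11) Skip pivot) z1 =
    if S j j <= 0 then tick z1 else exec pivot (tick z1).
  rewrite /= -[smem z 0 n n]/(smem z 0 j j) hS.
  by have -> : smem z1 11 0 0 = 0 by rewrite -[LHS]/(smem z 11 0 0) fm.
case: leP => [Sj|Sj].
  exists S; split=> // [i|].
    rewrite ltnS leq_eqVlt => /orP[/eqP ij|]; last exact: S0.
    by have -> : i = j; [exact: val_inj|exact: proj_diag_le0].
  split=> //; apply: leq_trans (_ : (time z).+2 <= _)%N => //.
  by rewrite -[reg _ _]/(reg z 2); lia.
have [] := @pivot_spec _ (tick z1).
  by rewrite -[LHS]/(smem z 11 0 0) fm.
set k := reg (tick z1) 2; set z2 := exec pivot (tick z1).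
have kE : k = reg z 2 by [].
have jE : reg (tick z1) 3 = j by [].
have rE : reg (tick z1) 1 = r by rewrite -[LHS]/(reg z 1) fr.
have sE a i l : smem (tick z1) a i l = smem z a i l by [].
rewrite jE rE => r2' p0 p7 p8 pt.
exists (S - deflated S j); split.
- exact: deflate_sym.
- by apply: deflate_idem; rewrite ?gt_eqF.
- by move=> i l; rewrite p0 // !sE !hS !mxE.
- move=> i; rewrite ltnS leq_eqVlt => /orP[/eqP ij|iN] l.
    have -> : i = j by exact: val_inj.
    by rewrite !mxE divff ?mulr1 ?subrr ?gt_eqF.
  (* A cleared column stays cleared: by symmetry row [i] of [S] vanishes too, so the subtracted term
     contains the zero factor [S i j]. *)
  rewrite !mxE (S0 i iN) sub0r.
  have -> : S i j = 0 by rewrite -St mxE S0.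
  by rewrite mul0r mulr0 oppr0.
split.
- move=> i l; rewrite r2' big_ord_recr /= p7 // p8 // !sE !hS QE.
  rewrite -kE !mxE.
  rewrite [in RHS](eq_bigr (fun t : 'I_k => smem z 7 t i * smem z 8 t l)).
    by ring.
  move=> t _; have tk : (t : nat) != k by rewrite neq_ltn ltn_ord.
  by rewrite (pt t i tk).1 (pt t l tk).2.
- by rewrite r2' mxtrace_deflate ?gt_eqF // trE -kE -natr1; ring.
have := @exec_cost _ [:: 0; 1]%N (reg s) pivot (tick z1).
rewrite -/z2 => /(_ _ isT isT) H.
have {H} : (time z2 <= time (tick z1) + cost (reg s) pivot)%N.
  by apply: H => x; rewrite !inE => /orP[] /eqP ->; exact: fr.
have -> : time (tick z1) = (time z).+2 by [].
by rewrite r2' kE; lia.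
Qed.

End Preprocessing.

(** * Correctness of one iteration *)

Section Iteration.
Variables (R : realType) (c : R) (n r : nat) (Q : 'M[R]_r).
Hypotheses (c02 : 0 < c < 2) (r0 : (0 < r)%N) (rn : (r <= n)%N).
Hypotheses (Q_sym : Q^T = Q) (Q_idem : Q *m Q = Q).

(** What every iteration needs and leaves intact. Array 0 is absent: Gram-Schmidt overwrites it, and
    from then on [Q] exists only through its factors. *)
Definition ready (s : state R) : Prop :=
  [/\ reg s 1 = r, factors Q s, smem s 1 0 0 = c, smem s 11 0 0 = 0 &
      [/\ smem s 9 0 0 = r%:R, smem s 10 0 0 = n%:R, smem s 12 0 0 = 1 &
          smem s 13 0 0 = 4 * r%:R ^+ 3]].

Lemma exec_ready p s : all (predC (mem [:: 1; 2]%N)) (written_regs p) ->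
  all (predC (mem [:: 1; 7; 8; 9; 10; 11; 12; 13]%N)) (written_arrays p) ->
  ready s -> ready (exec p s).
Proof.
move=> hr ha [r1 fac h1 h11 [h9 h10 h12 h13]].
have reE (x : nat) : x \in [:: 1; 2]%N -> reg (exec p s) x = reg s x.
  by move=> xin; rewrite exec_reg //; apply: contraL xin => /(allP hr).
have meE (a i j : nat) : a \in [:: 1; 7; 8; 9; 10; 11; 12; 13]%N ->
    smem (exec p s) a i j = smem s a i j.
  by move=> ain; rewrite exec_mem //; apply: contraL ain => /(allP ha).
split; [by rewrite reE| |by rewrite meE|by rewrite meE|by split; rewrite meE].
move=> i l; rewrite (fac i l) (reE 2%N) //.
by apply: eq_bigr => t _; rewrite !meE.
Qed.

Lemma all_iotaP (P : pred nat) :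
  reflect (forall i : 'I_r, P i) (all P (iota 0 r)).
Proof.
apply: (iffP allP) => [h i|h i]; first by apply: h; rewrite mem_iota /=.
by rewrite mem_iota /= add0n => ir; exact: (h (Ordinal ir)).
Qed.

Lemma exec_if (a b : nat) p q (s : state R) :
  exec (IfLe (scal a) (scal b) p q) s =
    if smem s a 0 0 <= smem s b 0 0 then exec p (tick s) else exec q (tick s).
Proof. by []. Qed.

Lemma decide_spec s y v : ready s -> ~ halted s -> holds s y v ->
  Q *m v = v -> (forall i, r%:R^-1 <= y i 0) ->
  (forall i : 'I_r, smem s 16 i 0 = qK Q v i 0) ->
  smem s 15 0 0 = dot (qK Q v) v -> smem s 17 0 0 = dot (qK Q v) (qK Q v) ->
  smem s 18 0 0 = `[< forall i, 0 < (y - v) i 0 >]%:R ->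
  smem s 19 0 0 = `[< (forall i, 0 < v i 0) /\ r = n >]%:R ->
  exists2 o, bp_iter c n Q y v o & reports (exec decide s) o.
Proof.
move=> rs nhalt hs Qv yr s16 s15 s17 s18 s19.
have s12 : smem s 12 0 0 = 1 by have [_ _ _ _ []] := rs.
have hy (i : 'I_r) : smem s 2 i 0 = y i 0 by case: (hs i).
have hv (i : 'I_r) : smem s 3 i 0 = v i 0 by case: (hs i).
(* Two branches end in a cut, [q_K = 0] and [alpha] above [- threshold]; they share this
   argument. *)
have cutE s' : smem s' 11 0 0 = 0 -> reg s' 1 = r ->
    smem s' 15 0 0 = dot (qK Q v) v ->
    (forall i : 'I_r, smem s' 3 i 0 = v i 0) ->
    ~ (forall i, 0 < (y - v) i 0) -> ~ ((forall i, 0 < v i 0) /\ r = n) ->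
    ~ (alpha Q v <= - threshold R r) ->
    exists2 o, bp_iter c n Q y v o & reports (exec cut s') o.
  move=> z11 z1 z15 zv nz nv nal.
  pose J := [set j | (0 < v j 0) &&
    (0 <= v j 0 + (dot (qK Q v) v + dot (qK Q v) v))]%SET.
  exists (Cut J).
    apply: BPCase0 => //.
      have [j jP] := cut_exists r0 Q_sym Q_idem Qv yr nz nal.
      by apply/set0Pn; exists j; rewrite inE.
    by move=> j; rewrite inE; exact: cut_bound.
  have [c4 c5 c6] := cut_spec z11; split=> // j.
  by rewrite c6 ?z1 // z15 zv inE.
rewrite /decide exec_if s12 s18 ler1n lt0b.
case: asboolP => [yv|nyv].
  by exists PrimalFeasible; [exact: BPCase1|rewrite /= /halted /write /=].
rewrite exec_if -[smem (tick s)]/(smem s) s12 s19 ler1n lt0b.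
case: asboolP => [vr|nvr].
  by exists DualFeasible; [exact: BPCase2|rewrite /= /halted /write /=].
rewrite !exec_seq; set s1 := exec (Arith _ _ _ _) _.
have rs1 : ready s1 by do 2!apply: exec_ready => //.
have e1 a i j : a != 14%N -> smem s1 a i j = smem s a i j.
  by move=> a14; rewrite /s1 exec_mem ?inE // exec_mem ?inE.
have s14 : smem s1 14 0 0 = 4 * r%:R ^+ 3 * dot (qK Q v) v * dot (qK Q v) v.
  rewrite /s1 /= /write /read /scal /= s15.
  by have [_ _ _ _ [_ _ _ ->]] := rs.
clearbody s1; have [rr1 _ rc1 r11 _] := rs1.
rewrite exec_if r11 e1 // s17.
case: leP => [w0|w0].
  apply: cutE => //; try by move=> *; rewrite -[LHS]/(smem s1 _ _ _) e1.
  by rewrite alpha_le_thresholdP // ltNge w0.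
rewrite exec_if -![smem (tick s1)]/(smem s1) e1 // s17 s14.
case: leP => [wle|wgt]; last first.
  apply: cutE => //; try by move=> *; rewrite -[LHS]/(smem s1 _ _ _) e1.
  by rewrite alpha_le_thresholdP // leNgt wgt andbF.
eexists; first by apply: BPUpdate => //; rewrite alpha_le_thresholdP // w0.
split.
  by rewrite /halted exec_mem // -[smem _]/(smem s1) e1.
have g1 : smem s1 1 0 0 * (smem s1 15 0 0 / smem s1 17 0 0) =
    c * (alpha Q v / norm2 (qK Q v)).
  by rewrite rc1 !e1 // s15 s17 alpha_div.
move=> i; have [] := @update_spec _ (tick (tick s1)) i.
  by rewrite -[reg _]/(reg s1) rr1.
rewrite -![smem (tick (tick s1))]/(smem s1) g1 r11 !e1 // s16 hy hv => -> ->.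
by rewrite !mxE sumKE; case: ifP; rewrite ?mulr1 ?mulr0.
Qed.

Lemma iteration_spec s y v : ready s -> ~ halted s -> holds s y v ->
  Q *m v = v -> (forall i, r%:R^-1 <= y i 0) ->
  exists2 o, bp_iter c n Q y v o & reports (exec iteration s) o.
Proof.
move=> rs nhalt hs Qv yr; have [r1 fac _ h11 _] := rs.
have hv (i : 'I_r) : smem s 3 i 0 = v i 0 by case: (hs i).
rewrite /iteration 4!exec_seq.
set s1 := exec compute_q s.
have rs1 : ready s1 by exact: exec_ready.
have e1 a i j : (a <= 4)%N -> smem s1 a i j = smem s a i j.
  by case: a => [|[|[|[|[|]]]]] // _; rewrite /s1 exec_mem.
have q1 (i : 'I_r) : smem s1 16 i 0 = qK Q v i 0.
  rewrite /s1 compute_q_spec r1 // h11 mxE.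
  (* Exchanging the sums turns [L^T (W 1_K)] into [(L^T W) 1_K]. *)
  under eq_bigr => t _ do rewrite mulr_sumr.
  rewrite exchange_big /=; apply: eq_bigr => k _.
  rewrite fac mulr_suml; apply: eq_bigr => t _.
  by rewrite hv sumKE; case: ifP; rewrite ?mulr1 ?mulr0.
clearbody s1; set s2 := exec compute_dots s1.
have rs2 : ready s2 by exact: exec_ready.
have e2 a i j : (a <= 4)%N -> smem s2 a i j = smem s a i j.
  by case: a => [|[|[|[|[|]]]]] // _; rewrite /s2 exec_mem // e1.
have q2 (i : 'I_r) : smem s2 16 i 0 = qK Q v i 0 by rewrite /s2 exec_mem.
have [] := compute_dots_spec s1; rewrite -/s2.
have [-> _ _ _ _] := rs1.
under eq_bigr do rewrite q1 e1 // hv.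
rewrite -/(dot (qK Q v) v).
under [in X in _ -> X -> _]eq_bigr do rewrite q1.
rewrite -/(dot (qK Q v) (qK Q v)) => s15 s17.
clearbody s2; set s3 := exec test_z s2.
have rs3 : ready s3 by exact: exec_ready.
have e3 a i j : (a <= 4)%N || (a \in [:: 15; 16; 17]%N) ->
    smem s3 a i j = smem s2 a i j.
  move=> ha; rewrite /s3 exec_mem // !inE.
  by apply: contraTN ha => /orP[] /eqP->.
have s18 := test_z_spec s2; rewrite -/s3 in s18.
clearbody s3; set s4 := exec test_v s3.
have e4 a i j : (a <= 4)%N || (a \in [:: 15; 16; 17; 18]%N) ->
    smem s4 a i j = smem s3 a i j.
  move=> ha; rewrite /s4 exec_mem // !inE.
  by apply: contraTN ha => /or3P[] /eqP->.
have rs4 : ready s4 by exact: exec_ready.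
apply: decide_spec => //.
- by rewrite /halted e4 // e3 // e2.
- by move=> i; rewrite !e4 // !e3 // !e2.
- by move=> i; rewrite e4 // e3.
- by rewrite e4 // e3.
- by rewrite e4 // e3.
- rewrite e4 // s18; have [-> _ _ _ _] := rs2.
  congr ((nat_of_bool _)%:R); apply/(all_iotaP _)/asboolP => h i; have := h i;
    by have [hyi hvi] := hs i; rewrite !e2 // hyi hvi !mxE subr_gt0.
(* The machine tests [n <= r], which amounts to [r = n] since [r <= n]. *)
- rewrite test_v_spec; have [-> _ _ -> [-> -> _ _]] := rs3.
  rewrite ler_nat; congr ((nat_of_bool _)%:R); apply/andP/asboolP => -[h nr].
    split=> [i|]; last by apply/eqP; rewrite eqn_leq rn.
    by have := elimT (all_iotaP _) h i; rewrite /= e3 // e2 // hv.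
  split; last by rewrite nr.
  by apply: (introT (all_iotaP _)) => i; rewrite e3 // e2 // hv.
Qed.

End Iteration.

(** * Complete runs: agreement with the procedure, halting and running time *)

Definition initialization : cmd :=
  constants ;; start_y ;; start_v ;; gram_schmidt.

Definition basic_procedure : program := Program initialization iteration.

Section Run.
Variables (R : realType) (c : R) (m n r : nat) (A : 'M[R]_(m, r)).
Hypotheses (c02 : 0 < c < 2) (r0 : (0 < r)%N) (cur : current_matrix m n r A).

Let Q := QA A.
Let runs t := run basic_procedure c n Q t.

Lemma current_matrix_le : (r <= n)%N.
Proof.
have [A0 [f [d [_ finj _ _]]]] := cur.
by have := leq_card f finj; rewrite !card_ord.
Qed.

Lemma preprocessing_spec :
  [/\ ready c n Q (runs 0), ~ halted (runs 0),
      holds (runs 0) (y0 R r) (Q *m y0 R r), (reg (runs 0) 2 <= m)%N &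
      (time (runs 0) <=
         4 * n ^ 2 + 11 * n + 20 + reg (runs 0) 2 * (11 * r ^ 2))%N].
Proof.
pose s0 := init_state c n Q.
have -> : runs 0 = exec initialization s0 by [].
have Q0 (i l : 'I_r) : smem s0 0 i l = Q i l by rewrite /= !valK.
have := @exec_cost R [:: 0; 1]%N (reg s0) (constants ;; start_y ;; start_v) s0
  (fun _ _ => erefl) isT isT.
rewrite /initialization 3!exec_seq 2!exec_seq.
have [s19 s110 s112 s113] := @constants_spec _ s0 erefl erefl.
set s1 := exec constants s0 in s19 s110 s112 s113 *.
have e1 a k l : a \in [:: 0; 1; 3; 4; 11]%N -> smem s1 a k l = smem s0 a k l.
  by move=> ha; rewrite /s1 exec_mem //; exact: (allP (_ : all (fun x =>
    x \notin written_arrays constants) _) _ ha).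
have r10 k : k != 3%N -> reg s1 k = reg s0 k.
  by move=> k3; rewrite /s1 exec_reg //= !inE !negb_or !k3.
have r11 : reg s1 1 = r by rewrite r10.
have r12 : reg s1 2 = 0%N by rewrite r10.
clearbody s1; set s2 := exec start_y s1.
have r21 : reg s2 1 = r by rewrite /s2 exec_reg.
have r22 : reg s2 2 = 0%N by rewrite /s2 exec_reg.
have e2 a k l : a != 2%N -> smem s2 a k l = smem s1 a k l.
  by move=> a2; rewrite /s2 exec_mem // inE.
have y2 (i : 'I_r) : smem s2 2 i 0 = y0 R r i 0.
  by rewrite start_y_spec // ?r11 // s19 mxE.
clearbody s2; set s3 := exec start_v s2.
have r31 : reg s3 1 = r by rewrite /s3 exec_reg.
have r32 : reg s3 2 = 0%N by rewrite /s3 exec_reg.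
have e3 a k l : a \notin [:: 3; 14]%N -> smem s3 a k l = smem s2 a k l.
  move=> ha; rewrite /s3 exec_mem //=; apply: contra ha.
  by rewrite !inE => /orP[] /eqP ->.
have v3 (i : 'I_r) : smem s3 3 i 0 = (Q *m y0 R r) i 0.
  rewrite start_v_spec ?r21 //; last by rewrite e2 // e1.
  rewrite (e2 9%N) // s19 mxE.
  by apply: eq_bigr => k _; rewrite e2 // e1 // Q0 [y0 _ _ _ _]mxE.
clearbody s3 => ht3.
have Q3 (i l : 'I_r) : smem s3 0 i l = Q i l by rewrite e3 // e2 // e1.
have s311 : smem s3 11 0 0 = 0 by rewrite e3 // e2 // e1.
have [fac trQ ht] :=
  gram_schmidt_spec (QA_sym A) (QA_idem A) r31 r32 s311 Q3.
set s4 := exec gram_schmidt s3 in fac trQ ht *.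
have r41 : reg s4 1 = r by rewrite /s4 exec_reg.
have e4 a k l : a \in [:: 1; 2; 3; 4; 9; 10; 11; 12; 13]%N ->
    smem s4 a k l = smem s3 a k l.
  by move=> ha; rewrite /s4 exec_mem //; exact: (allP (_ : all (fun x =>
    x \notin written_arrays gram_schmidt) _) _ ha).
clearbody s4; split.
- split=> //; last by split; rewrite e4 // e3 // e2.
    by rewrite e4 // e3 // e2 // e1.
  by rewrite e4.
- by rewrite /halted e4 // e3 // e2 // e1 //= => /esym/eqP; rewrite oner_eq0.
- by move=> i; rewrite !e4 // v3 e3.
- by rewrite -(ler_nat R) trQ mxtrace_QA.
apply: leq_trans ht _.
have rn := current_matrix_le.
have -> : cost (reg s3) pivot = (r * 3 + 1 + (r * (r * 3 + 1 + 1) + 1) + 1)%N.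
  by rewrite /= !r31; lia.
move: ht3; rewrite /=; set k := reg s4 2; set T := time s3.
move=> ht3.
(* A pivot costs [3 r^2 + 5 r + 3], and the coefficients sum to 11. *)
suff : (k * (r * 3 + 1 + (r * (r * 3 + 1 + 1) + 1) + 1) <= k * (11 * r ^ 2))%N.
  by have : (r * r <= n * n)%N by [rewrite leq_mul]; lia.
by rewrite leq_mul2l; apply/orP; right; nia.
Qed.

Lemma run_step t y v : ready c n Q (runs t) -> ~ halted (runs t) ->
  holds (runs t) y v -> bp_reaches c n Q t y v ->
  exists2 o, bp_iter c n Q y v o & reports (runs t.+1) o.
Proof.
move=> rd nh hd H; have [Qs QQ] := (QA_sym A, QA_idem A).
have [yr vy _] := bp_reaches_inv r0 Qs QQ c02 H.
apply: (iteration_spec r0 current_matrix_le Qs QQ rd nh hd) => //.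
by rewrite vy mulmxA QA_idem.
Qed.

Lemma run_reaches t y v : bp_reaches c n Q t y v ->
  [/\ ready c n Q (runs t), ~ halted (runs t), holds (runs t) y v &
      reg (runs t) 2 = reg (runs 0) 2].
Proof.
elim=> [|{}t {}y {}v y' v' Hr [rd nh hd r2] Hi].
  by have [] := preprocessing_spec.
have [o Ho rep] := run_step rd nh hd Hr.
have oE := bp_iter_continue Hi Ho; rewrite oE in rep.
have [nh' hd'] := rep; split=> //.
  exact: exec_ready.
by rewrite -r2 /runs /run iterS exec_reg.
Qed.

(** The main loop runs over the rows of the factors, each pass being linear in [r]. The successor
    covers the loops over [r] alone. *)
Lemma cost_iteration e : e 1%N = r ->
  (cost e iteration <= 40 * (r * (e 2%N).+1))%N.
Proof. by move=> er /=; rewrite er; nia. Qed.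

Lemma run_time t y v : bp_reaches c n Q t y v ->
  (time (runs t.+1) <=
     time (runs 0) + t.+1 * (40 * (r * (reg (runs 0) 2).+1)))%N.
Proof.
have step u : reg (runs u) 1 = r -> reg (runs u) 2 = reg (runs 0) 2 ->
    (time (runs u.+1) <= time (runs u) + 40 * (r * (reg (runs 0) 2).+1))%N.
  move=> ru1 ru2; have := @exec_cost R [:: 1; 2]%N (reg (runs u)) iteration
    (runs u) (fun _ _ => erefl) isT isT.
  move=> h; apply: leq_trans h _; rewrite leq_add2l -ru2.
  exact: cost_iteration.
elim=> [|{}t {}y {}v y' v' Hr IH Hi].
  have [[r1 _ _ _ _] _ _ r2] := run_reaches (BPStart c n Q).
  by rewrite mul1n; exact: step.
have [[r1 _ _ _ _] _ _ r2] := run_reaches (BPNext Hr Hi).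
by apply: leq_trans (step _ r1 r2) _; rewrite [in leqRHS]mulSn; lia.
Qed.

(** An iteration that does not halt produces a further iterate, so [N] of them in a row would
    contradict the bound. Stopping at the first halt supplies the minimality that [bp_time] asks
    for. *)
Lemma run_halts N : (forall t y v, bp_reaches c n Q t y v -> (t < N)%N) ->
  exists t y v, [/\ bp_reaches c n Q t y v, halted (runs t.+1) &
    forall t', (t' < t)%N -> ~ halted (runs t'.+1)].
Proof.
move=> bnd.
suff [//|[y [v [H _]]]] : (exists t y v, [/\ bp_reaches c n Q t y v,
    halted (runs t.+1) & forall t', (t' < t)%N -> ~ halted (runs t'.+1)]) \/
  exists y v, bp_reaches c n Q N y v /\
    forall t', (t' < N)%N -> ~ halted (runs t'.+1).
  by have := bnd _ _ _ H; rewrite ltnn.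
elim: {bnd}N => [|N [IH|[y [v [H nh]]]]]; [|by left|].
  by right; exists (y0 R r), (Q *m y0 R r); split=> //; exact: BPStart.
have [rd nhN hd _] := run_reaches H.
have [o Ho rep] := run_step rd nhN hd H.
case: o Ho rep => [||J|y' v'] Ho rep; try by left; exists N, y, v; case: rep.
right; exists y', v'; split=> [|t']; first exact: BPNext H Ho.
by rewrite ltnS leq_eqVlt => /orP[/eqP ->|]; [case: rep|exact: nh].
Qed.

(** The constant is [46 = 4 + 11 + 20 + 11], every term being at most its coefficient times
    [m n^2]. *)
Lemma preprocessing_time : (0 < m)%N -> (time (runs 0) <= 46 * (m * n ^ 2))%N.
Proof.
move=> m0; have [_ _ _ km ht] := preprocessing_spec.
have rn := current_matrix_le.
apply: leq_trans ht _.
have kr : (reg (runs 0) 2 * (11 * r ^ 2) <= m * (11 * n ^ 2))%N.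
  by rewrite leq_mul // leq_mul2l leq_sqr rn.
have nn : (n ^ 2 <= m * n ^ 2)%N by rewrite leq_pmull.
have n1 : (n <= n ^ 2)%N by nia.
by apply: leq_trans (leq_add (leqnn _) kr) _; lia.
Qed.

(** Without rows the all-ones vector would be a solution. Positivity of [m] lets the factor [m] in
    the time bound absorb costs that do not depend on it. *)
Lemma infeasible_rows_gt0 : primal_infeasible A -> (0 < m)%N.
Proof.
case: (posnP m) => // m0 []; exists (const_mx 1); split.
- by apply/colP => i; have := ltn_ord i; rewrite {2}m0.
- by move=> j; rewrite mxE ler01 lexx.
- by move/colP/(_ (Ordinal r0)) => /eqP; rewrite !mxE oner_eq0.
Qed.

Lemma bp_time_bound : primal_infeasible A ->
  exists T : nat, bp_time basic_procedure c n Q T /\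
    T%:R <= (126 + 320 / c) * (n%:R ^+ 2 * m%:R / rho Q).
Proof.
move=> inf; have m0 := infeasible_rows_gt0 inf; have [c0 c2] := andP c02.
have rho0 : 0 < rho Q by exact: rho_QA_gt0.
have rho1 : rho Q <= 1 by exact: rho_le1.
(* Any fixed fraction of [rho Q] would do; one half turns the bound [2 r / (c d)] on the number of
   updates into [4 r / (c rho)]. *)
have half : rho Q / 2 < rho Q by lra.
have h0 : 0 < rho Q / 2 by lra.
have [x x1 xq] := rho_witness r0 half rho0.
have bnd t y v : bp_reaches c n Q t y v -> t%:R <= 4 * r%:R / (c * rho Q).
  move=> /(bp_reaches_bound r0 (QA_sym A) (QA_idem A) c02 x1 h0 xq) H.
  by rewrite ler_pdivlMr ?mulr_gt0 //; lra.
have [|t [y [v [H ht hlt]]]] := @run_halts (Num.bound (4 * r%:R / (c * rho Q))).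
  move=> t y v /bnd H; rewrite -(ltr_nat R); apply: le_lt_trans H _.
  by rewrite archi_boundP // divr_ge0 ?mulr_ge0 ?ler0n // ltW ?mulr_gt0.
exists (time (runs t.+1)); split; first by exists t.
have Ht := bnd _ _ _ H; have rn := current_matrix_le.
have [_ _ _ km _] := preprocessing_spec.
have T1 : (time (runs t.+1) <= 46 * (m * n ^ 2) + t.+1 * (80 * (n * m)))%N.
  apply: leq_trans (run_time H) _.
  apply: leq_add; first exact: preprocessing_time.
  (* There are at most [m] rows and [m >= 1], so their number plus one is at most [2 m]; this
     doubles 40 to 80. *)
  have h : (r * (reg (runs 0) 2).+1 <= n * (m + m))%N.
    by rewrite leq_mul //; lia.
  rewrite leq_mul2l; apply/orP; right.
  by move: h; move: (_ * _.+1)%N => a h; lia.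
apply: le_trans (_ : (46 * (m * n ^ 2) + t.+1 * (80 * (n * m)))%:R <= _).
  by rewrite ler_nat.
rewrite !(natrD, natrM, natrX) -[t.+1%:R]natr1.
have n1 : r%:R <= n%:R :> R by rewrite ler_nat.
have r1 : 1 <= r%:R :> R by rewrite ler1n.
have m1 : 1 <= m%:R :> R by rewrite ler1n.
have i0 : 1 <= (rho Q)^-1 by rewrite invf_ge1.
(* The extra 1 is the final, halting iteration; it is absorbed because [n / rho >= 1]. *)
have Ht' : t%:R + 1 <= (4 / c + 1) * (n%:R * (rho Q)^-1).
  have -> : (4 / c + 1) * (n%:R * (rho Q)^-1) =
    4 * n%:R / (c * rho Q) + n%:R * (rho Q)^-1 by field; rewrite !gt_eqF.
  rewrite lerD // ?(le_trans Ht) //.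
    by rewrite ler_pM2r ?invr_gt0 ?mulr_gt0 // ler_pM2l.
  by rewrite -[leLHS]mulr1 ler_pM // (le_trans r1).
(* The constants are [126 = 46 + 80] and [320 = 4 * 80]. *)
have -> : (126 + 320 / c) * (n%:R ^+ 2 * m%:R / rho Q) =
  46 * (m%:R * n%:R ^+ 2) * (rho Q)^-1 +
  (4 / c + 1) * (n%:R * (rho Q)^-1) * (80 * (n%:R * m%:R)).
  by field; rewrite !gt_eqF.
apply: lerD.
  by rewrite ler_peMr // !mulr_ge0 // exprn_ge0.
by rewrite ler_wpM2r // !mulr_ge0.
Qed.

End Run.

Theorem lemma4 (R : realType) :
  exists P : program,
    [/\ implements_bp R P /\ cheap_preprocessing R P,
        forall c : R, 0 < c < 2 ->
          exists C : R, forall (m n r : nat) (A : 'M[R]_(m, r)),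
            (0 < r)%N -> current_matrix m n r A -> primal_infeasible A ->
            exists T : nat,
              bp_time P c n (QA A) T /\
              T%:R <= C * (n%:R ^+ 2 * m%:R / rho (QA A)),
        forall n : nat, (0 < n)%N ->
          rho (QA (1%:M : 'M[R]_n)) = (Num.sqrt n%:R)^-1
      & forall c : R, 0 < c < 2 ->
          exists C : R, forall (m n r : nat) (A : 'M[R]_(m, r)),
            (0 < r)%N -> current_matrix m n r A -> primal_infeasible A ->
            rho (QA A) = (Num.sqrt n%:R)^-1 ->
            exists T : nat,
              bp_time P c n (QA A) T /\
              T%:R <= C * (Num.sqrt (n%:R ^+ 5) * m%:R)].
Proof.
exists basic_procedure; split.
- split.
    move=> c m n r A c02 r0 cur t y v H.
    have [rd nh hd _] := run_reaches c02 r0 cur H.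
    by split=> //; exact: run_step H.
  exists 46 => c m n r A c02 m0 r0 cur.
  have := preprocessing_time c02 r0 cur m0.
  by rewrite -(ler_nat R) natrM natrM natrX.
- move=> c c02; exists (126 + 320 / c) => m n r A r0 cur inf.
  exact: bp_time_bound.
- exact: rho_QA1.
- move=> c c02; exists (126 + 320 / c) => m n r A r0 cur inf rhoE.
  have [T [hT leT]] := bp_time_bound c02 r0 cur inf.
  exists T; split=> //; apply: le_trans leT _.
  (* Here [n^2 sqrt n = sqrt (n^5)], by splitting off the square [n^4]. *)
  rewrite rhoE invrK (exprD _ 4 1) sqrtrM ?exprn_ge0 ?ler0n //.
  rewrite (exprM _ 2 2) sqrtr_sqr ger0_norm ?exprn_ge0 ?ler0n // expr1.
  by rewrite mulrAC.
Qed.
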